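(* Let $n,m\ge 1$ and let $f_1,\ldots,f_n\in\mathbb{C}[[t_1,\ldots,t_m]]$ and $g_{i,j}\in\mathbb{C}[[t_1,\ldots,t_m]]$ ($1\le i<j\le n$) be power series, where the $f_i$ have no constant term. Let $A$ be the $n\times n$ upper triangular matrix with diagonal $(f_1,\ldots,f_n)$ and with $(i,j)$ entry equal to $g_{i,j}$ for $i<j$. Let $N=\dim_{\mathbb{Q}}\langle f_1,\ldots,f_n\rangle_{\mathbb{Q}}$. Then $$\operatorname{tr.d.}_{\mathbb{C}}\,\mathbb{C}(A,E(A))\ \ge\ N+\operatorname{rank}\big(J(\vec f,\vec g;\vec t)\big).$$
   Context: $E(A)=\sum_{r\ge 0}A^r/r!$ is the matrix exponential; since the diagonal entries of the upper triangular matrix $A$ have no constant term, it is a well-defined matrix over $\mathbb{C}[[t_1,\ldots,t_m]]$. $\mathbb{C}(A,E(A))$ is the subfield of the fraction field of $\mathbb{C}[[t_1,\ldots,t_m]]$ generated over $\mathbb{C}$ by all entries of $A$ and of $E(A)$; $\operatorname{tr.d.}_{\mathbb{C}}$ is transcendence degree over $\mathbb{C}$. $\langle f_1,\ldots,f_n\rangle_{\mathbb{Q}}$ is the $\mathbb{Q}$-linear span of the $f_i$. $J(\vec f,\vec g;\vec t)$ is the $\frac{n(n+1)}{2}\times m$ Jacobian matrix with entries $\partial h_s/\partial t_j$, where $h_s$, $1\le s\le \frac{n(n+1)}{2}$, is an ordering of the $f_i$ and the $g_{i,j}$; its rank is taken over the fraction field of $\mathbb{C}[[t_1,\ldots,t_m]]$.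 *)

(* Defs.v *)
From HB Require Import structures.
From mathcomp Require Import all_boot all_order all_algebra.
From mathcomp Require Import finmap.
From mathcomp Require Import boolp classical_sets functions cardinality fsbigop.
From mathcomp Require Import reals complex.
From mathcomp Require Import mpoly.

Set Implicit Arguments.
Unset Strict Implicit.
Unset Printing Implicit Defensive.

Import Order.TTheory GRing.Theory Num.Theory.

Local Open Scope ring_scope.

(* F[[t_1, ..., t_m]]: a power series is its family of coefficients, indexed
   by the exponents 'X_{1..m}. The record prevents the pointwise ring structure
   on functions from being inferred. *)
Record fps (F : fieldType) (m : nat) := Fps { fcoef :> 'X_{1..m} -> F }.

Section FpsRing.
Variables (F : fieldType) (m : nat).
Local Notation fps := (fps F m).
Implicit Types (p q r : fps) (a b c : 'X_{1..m}).

HB.instance Definition _ := gen_eqMixin fps.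
HB.instance Definition _ := gen_choiceMixin fps.

Lemma fpsP p q : (forall a, p a = q a) -> p = q.
Proof. by case: p q => [p] [q] /= /funext ->. Qed.

Definition fps_zero : fps := Fps (fun=> 0).
Definition fps_opp p : fps := Fps (fun a => - p a).
Definition fps_add p q : fps := Fps (fun a => p a + q a).
Definition fps_one : fps := Fps (fun a => (a == 0%MM)%:R).
Definition fps_mul p q : fps :=
  Fps (fun a => \sum_(k : 'X_{1..m < (mdeg a).+1, (mdeg a).+1}
                      | a == (k.1 + k.2)%MM) p k.1 * q k.2).
Definition fps_scale (x : F) p : fps := Fps (fun a => x * p a).

Lemma fps_addA : associative fps_add.
Proof. by move=> p q r; apply: fpsP => a; rewrite /= addrA. Qed.
Lemma fps_addC : commutative fps_add.
Proof. by move=> p q; apply: fpsP => a; rewrite /= addrC. Qed.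
Lemma fps_add0 : left_id fps_zero fps_add.
Proof. by move=> p; apply: fpsP => a; rewrite /= add0r. Qed.
Lemma fps_addN : left_inverse fps_zero fps_opp fps_add.
Proof. by move=> p; apply: fpsP => a; rewrite /= addNr. Qed.

HB.instance Definition _ :=
  GRing.isZmodule.Build fps fps_addA fps_addC fps_add0 fps_addN.

Definition fps_trunc d p : {mpoly F[m]} :=
  \sum_(b : 'X_{1..m < d}) p b *: 'X_[b].

Lemma mcoeff_trunc d p a : (mdeg a < d)%N -> (fps_trunc d p)@_a = p a.
Proof.
move=> lt_ad; rewrite raddf_sum /= (bigD1 (BMultinom lt_ad)) //=.
rewrite mcoeffZ mcoeffX eqxx mulr1 big1 ?addr0 // => b ne_b.
by rewrite mcoeffZ mcoeffX; case: eqP => [eq_b|]; rewrite ?mulr0 //;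
   case/eqP: ne_b; apply/val_inj.
Qed.

Lemma fps_mul_mpoly d p q (P Q : {mpoly F[m]}) :
    (forall a, (mdeg a < d)%N -> P@_a = p a) ->
    (forall a, (mdeg a < d)%N -> Q@_a = q a) ->
  forall a, (mdeg a < d)%N -> (P * Q)@_a = fps_mul p q a.
Proof.
move=> hP hQ a lt_ad; rewrite mcoeffM; apply: eq_bigr => k _.
by rewrite hP ?hQ //; apply: leq_trans (bmdeg _) lt_ad.
Qed.

Lemma fps_mulA : associative fps_mul.
Proof.
move=> p q r; apply: fpsP => a; pose d := (mdeg a).+1.
have tr s b : (mdeg b < d)%N -> (fps_trunc d s)@_b = s b.
  exact: mcoeff_trunc.
have tM s s' := fps_mul_mpoly (tr s) (tr s').
by rewrite -(fps_mul_mpoly (tr p) (tM q r)) // -(fps_mul_mpoly (tM p q) (tr r))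
           // mulrA.
Qed.

Lemma fps_mulC : commutative fps_mul.
Proof.
move=> p q; apply: fpsP => a; pose d := (mdeg a).+1.
have tr s b : (mdeg b < d)%N -> (fps_trunc d s)@_b = s b.
  exact: mcoeff_trunc.
by rewrite -!(fps_mul_mpoly (tr _) (tr _)) // mulrC.
Qed.

Lemma fps_mul1 : left_id fps_one fps_mul.
Proof.
move=> p; apply: fpsP => a; pose d := (mdeg a).+1.
have tr s b : (mdeg b < d)%N -> (fps_trunc d s)@_b = s b.
  exact: mcoeff_trunc.
rewrite -(@fps_mul_mpoly d _ _ 1 _ _ (tr p)) ?mul1r ?tr // => b _.
by rewrite mcoeff1.
Qed.

Lemma fps_mulDl : left_distributive fps_mul +%R.
Proof.
move=> p q r; apply: fpsP => a; rewrite /= -big_split /=.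
by apply: eq_bigr => k _; rewrite mulrDl.
Qed.

Lemma fps_one_neq0 : fps_one != 0.
Proof.
apply/eqP => /(congr1 (fun p : fps => p 0%MM)) /= /eqP.
by rewrite eqxx oner_eq0.
Qed.

HB.instance Definition _ := GRing.Zmodule_isComNzRing.Build fps
  fps_mulA fps_mulC fps_mul1 fps_mulDl fps_one_neq0.

Lemma fps_scaleA x y p : fps_scale x (fps_scale y p) = fps_scale (x * y) p.
Proof. by apply: fpsP => a; rewrite /= mulrA. Qed.
Lemma fps_scale1 : left_id 1 fps_scale.
Proof. by move=> p; apply: fpsP => a; rewrite /= mul1r. Qed.
Lemma fps_scaleDr : right_distributive fps_scale +%R.
Proof. by move=> x p q; apply: fpsP => a; rewrite /= mulrDr. Qed.
Lemma fps_scaleDl p : {morph fps_scale^~ p : x y / x + y}.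
Proof. by move=> x y; apply: fpsP => a; rewrite /= mulrDl. Qed.

HB.instance Definition _ := GRing.Zmodule_isLmodule.Build F fps
  fps_scaleA fps_scale1 fps_scaleDr fps_scaleDl.

Lemma fps_scaleAl (x : F) p q : x *: (p * q) = (x *: p) * q.
Proof.
apply: fpsP => a; rewrite /= mulr_sumr.
by apply: eq_bigr => k _; rewrite mulrA.
Qed.

HB.instance Definition _ := GRing.Lmodule_isLalgebra.Build F fps fps_scaleAl.
HB.instance Definition _ := GRing.Lalgebra_isComAlgebra.Build F fps.

Lemma fcoef0 a : (0 : fps) a = 0. Proof. by []. Qed.
Lemma fcoefN p a : (- p) a = - p a. Proof. by []. Qed.
Lemma fcoefD p q a : (p + q) a = p a + q a. Proof. by []. Qed.
Lemma fcoef1 a : (1 : fps) a = (a == 0%MM)%:R. Proof. by []. Qed.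
Lemma fcoefZ x p a : (x *: p) a = x * p a. Proof. by []. Qed.
Lemma fcoefM p q a :
  (p * q) a = \sum_(k : 'X_{1..m < (mdeg a).+1, (mdeg a).+1}
                        | a == (k.1 + k.2)%MM) p k.1 * q k.2.
Proof. by []. Qed.
Lemma fcoef_sum (I : Type) (s : seq I) (P : pred I) (G : I -> fps) a :
  (\sum_(i <- s | P i) G i) a = \sum_(i <- s | P i) G i a.
Proof. exact: (big_morph (fun p : fps => p a)). Qed.

Lemma fps_neq0P p : p != 0 ->
  exists2 a, p a != 0 & forall b, (b < a)%O -> p b = 0.
Proof.
move=> p0; apply: contrapT => no; case/eqP: p0; apply: fpsP.
apply: ltmwf => a IH; apply: contrapT => /eqP pa.
by apply: no; exists a.
Qed.

Lemma fps_mul_neq0 p q : p != 0 -> q != 0 -> p * q != 0.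
Proof.
move=> /fps_neq0P[a pa pmin] /fps_neq0P[b qb qmin]; apply/eqP.
move=> /(congr1 (fun r : fps => r (a + b)%MM)); rewrite fcoefM /=.
have ha : (mdeg a < (mdeg (a + b)%MM).+1)%N by rewrite ltnS mdegD leq_addr.
have hb : (mdeg b < (mdeg (a + b)%MM).+1)%N by rewrite ltnS mdegD leq_addl.
rewrite (bigD1 (BMultinom ha, BMultinom hb)) //= big1 ?addr0 => [/eqP|].
  by rewrite mulf_eq0 (negPf pa) (negPf qb).
case=> [[c hc] [e he]] /= /andP[/eqP eqab ne].
case: (ltP c a) => [/pmin ->|le_ac]; first by rewrite mul0r.
case: (ltP e b) => [/qmin ->|le_be]; first by rewrite mulr0.
have eca : c = a.
  apply/eqP; rewrite eq_le le_ac andbT leNgt; apply/negP => lt_ac.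
  by have := ltmc_le_add lt_ac le_be; rewrite eqab ltxx.
have eeb : e = b.
  by apply/mnmP => i; move/mnmP/(_ i): eqab; rewrite !mnmDE eca => /addnI.
by case/eqP: ne; congr pair; apply: val_inj.
Qed.

Definition fps_unit : {pred fps} := fun p => `[< exists q, q * p = 1 >].
Definition fps_inv p : fps :=
  if p \in fps_unit then xget p [set q | q * p = 1]%classic else p.

Lemma fps_mulVr : {in fps_unit, left_inverse 1 fps_inv *%R}.
Proof.
move=> p up; rewrite /fps_inv up; move: up => /asboolP ex.
exact: (@xgetPex fps p [set q | q * p = 1]%classic ex).
Qed.
Lemma fps_unitP p q : q * p = 1 -> p \in fps_unit.
Proof. by move=> qp; apply/asboolP; exists q. Qed.
Lemma fps_inv_out : {in [predC fps_unit], fps_inv =1 id}.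
Proof. by move=> p; rewrite inE /fps_inv => /negPf ->. Qed.

HB.instance Definition _ := GRing.ComNzRing_hasMulInverse.Build fps
  fps_mulVr fps_unitP fps_inv_out.

Lemma fps_integral p q : p * q = 0 -> (p == 0) || (q == 0).
Proof.
move=> pq; apply/norP => -[p0 q0].
by move: (fps_mul_neq0 p0 q0); rewrite pq eqxx.
Qed.

HB.instance Definition _ := GRing.ComUnitRing_isIntegral.Build fps fps_integral.

Definition fps_deriv (j : 'I_m) p : fps :=
  Fps (fun a => p (a + U_(j))%MM *+ (a j).+1).

Definition fps_const (x : F) : {fraction fps} := tofrac (x%:A : fps).

End FpsRing.

Section MatrixExponential.
Variables (F : fieldType) (m n : nat).
Local Notation fps := (fps F m).
Implicit Types (A : 'M[fps]_n) (f : 'I_n -> fps) (g : 'I_n -> 'I_n -> fps).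

(* The sum over r is finite coefficientwise (fcoef_expmx_finite below), which
   is what convergence means in the power series ring; \sum_(r \in setT) sums
   the nonzero terms of a finitely supported family. *)
Definition expmx A : 'M[fps]_n := \matrix_(i, j)
  Fps (fun a => \sum_(r \in [set: nat]) ((r`!%:R)^-1 *: (A ^+ r) i j) a).

(* The values g i j with j <= i are ignored. *)
Definition upper_mx f g : 'M[fps]_n := \matrix_(i, j)
  if i == j then f i else if (i < j)%N then g i j else 0.

Definition upper_pairs : {set 'I_n * 'I_n} :=
  [set ij : 'I_n * 'I_n | (ij.1 <= ij.2)%N].

Lemma card_upper_pairs : #|upper_pairs| = (n * n.+1)./2.
Proof.
rewrite -sum1dep_card -(pair_big_dep xpredT (fun i j : 'I_n => (i <= j)%N)
  (fun _ _ => 1%N)) /= (exchange_big_dep xpredT) //=.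
transitivity (\sum_(j < n) j.+1)%N.
  apply: eq_bigr => j _; rewrite -[RHS]card_ord -sum1_card.
  by rewrite (big_ord_widen n (fun=> 1%N) (ltn_ord j)).
have := bin2_sum n.+1; rewrite bin2 mulnC => <-.
by rewrite big_mkord big_ord_recl.
Qed.

(* Row s holds the partial derivatives of the s-th entry of upper_mx f g on or
   above the diagonal, i.e. of the s-th element of an enumeration of the f_i
   and the g_ij, i < j. *)
Definition jacobian f g : 'M[{fraction fps}]_(#|upper_pairs|, m) :=
  \matrix_(s, j) tofrac
    (fps_deriv j (upper_mx f g (enum_val s).1 (enum_val s).2)).

Definition mx_entries A : set {fraction fps} :=
  [set x | exists i j, x = tofrac (A i j)]%classic.

Lemma fcoef_upper_expr f g (i j : 'I_n) r a :
    (forall k, f k 0%MM = 0) ->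
    (j < i)%N || (mdeg a + j < r + i)%N ->
  (upper_mx f g ^+ r) i j a = 0.
Proof.
move=> f0; elim: r i j a => [|r IH] i j a.
  rewrite expr0 mxE add0n; case: eqP => [<-|_ _] /=; last by [].
  by rewrite ltnn ltnNge leq_addl.
move=> lt_r; rewrite exprS mxE fcoef_sum big1 // => k _.
rewrite mxE fcoefM big1 // => -[[b /= _] [c /= _]] /eqP eab.
have da : mdeg a = (mdeg b + mdeg c)%N by rewrite -mdegD -eab.
have [eik|neik] := eqVneq i k.
  have [b0|nb0] := eqVneq b 0%MM; first by rewrite b0 f0 mul0r.
  rewrite IH ?mulr0 //; rewrite -eik; case/orP: lt_r => [->//|lt_r].
  apply/orP; right; move: lt_r; rewrite da addSn ltnS; apply: leq_trans.
  by rewrite ltn_add2r -addn1 addnC leq_add2r lt0n mdeg_eq0.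
case: ltnP => [lt_ik|_]; last by rewrite mul0r.
rewrite IH ?mulr0 //; case/orP: lt_r => [lt_ji|lt_r].
  by rewrite (ltn_trans lt_ji lt_ik).
apply/orP; right; apply: (@leq_ltn_trans (mdeg a + j)).
  by rewrite da leq_add2r leq_addl.
by apply: leq_trans lt_r _; rewrite addSnnS leq_add2l.
Qed.

Lemma fcoef_expmx_finite f g (i j : 'I_n) a :
    (forall k, f k 0%MM = 0) ->
  finite_set [set r | ((r`!%:R)^-1 *: (upper_mx f g ^+ r) i j) a != 0]%classic.
Proof.
move=> f0; apply: (sub_finite_set _ (finite_II (mdeg a + j).+1)).
move=> r /=; apply: contraNT; rewrite -leqNgt => le_r.
rewrite fcoef_upper_expr ?mulr0 //; apply/orP; right.
by apply: leq_trans le_r _; rewrite leq_addr.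
Qed.

End MatrixExponential.

Section RationalDimension.
Variables (F : numFieldType) (V : lmodType F).

Definition ratspan k (v : 'I_k -> V) : set V :=
  [set x | exists q : 'I_k -> rat, x = \sum_i ratr (q i) *: v i]%classic.

Definition ratfree k (v : 'I_k -> V) : Prop :=
  forall q : 'I_k -> rat, \sum_i ratr (q i) *: v i = 0 -> forall i, q i = 0.

(* The number of elements of a rational basis of S (0 if there is no finite
   one). *)
Definition ratdim (S : set V) : nat := xget 0%N
  [set k | exists b : 'I_k -> V, ratfree b /\ ratspan b = S]%classic.

Lemma ratspan_basis n (v : 'I_n -> V) :
  exists k (b : 'I_k -> V), ratfree b /\ ratspan b = ratspan v.
Proof.
elim: n v => [|n IH] v; first by exists 0%N, v; split=> // q _ [].
have [free_v|] := pselect (ratfree v); first by exists n.+1, v.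
move=> /existsNP[q /not_implyP[q0 /existsNP[i0 /eqP qi]]].
have [k [b [free_b span_b]]] := IH (v \o lift i0).
exists k, b; split=> //; rewrite span_b; apply/seteqP; split=> x [c ->].
  exists (fun i => if unlift i0 i is Some j then c j else 0).
  rewrite (bigD1_ord i0) //= unlift_none raddf0 scale0r add0r.
  by apply: eq_bigr => j _; rewrite liftK.
exists (fun j => c (lift i0 j) - c i0 / q i0 * q (lift i0 j)).
rewrite (bigD1_ord i0) //=; under [RHS]eq_bigr do
  rewrite rmorphB rmorphM scalerBl -scalerA.
rewrite sumrB -scaler_sumr.
have /eqP : \sum_i ratr (q i) *: v i = 0 by [].
rewrite (bigD1_ord i0) //= addr_eq0 => /eqP/esym/eqP; rewrite eqr_oppLR => /eqP.
move=> ->; rewrite scalerN opprK scalerA -rmorphM divfK // addrC.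
by [].
Qed.

End RationalDimension.

Section TranscendenceDegree.
Variables (F K : fieldType) (iota : F -> K).

(* iota(F)(G) *)
Definition gen_subfield (G : set K) : set K := [set x | forall S : {pred K},
  GRing.divring_closed S -> (forall c, iota c \in S) ->
  (forall y, G y -> y \in S) -> x \in S]%classic.

Definition alg_indep k (x : 'I_k -> K) : Prop :=
  forall P : {mpoly F[k]}, mmap iota x P = 0 -> P = 0.

Definition algebraic_over (L : set K) (x : K) : Prop :=
  exists p : {poly K}, [/\ p != 0, (forall i, L p`_i) & root p x].

Definition transcendence_basis (L : set K) k (b : 'I_k -> K) : Prop :=
  [/\ forall i, L (b i), alg_indep b
    & forall x, L x -> algebraic_over (gen_subfield (range b)) x].

(* The number of elements of a transcendence basis of L over iota(F) (0 if
   there is no finite one). *)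
Definition trdeg (L : set K) : nat := xget 0%N
  [set k | exists b : 'I_k -> K, transcendence_basis L b]%classic.

End TranscendenceDegree.

(* Main.v *)
From HB Require Import structures.
Require Import Defs.
From mathcomp Require Import all_boot all_order all_algebra.
From mathcomp Require Import boolp classical_sets functions cardinality fsbigop.
From mathcomp Require Import reals complex mpoly.
From mathcomp Require Import separable ring zify.

(** The statement follows from Ax's theorem on exponentials of power series,
    proved here with derivations of the fraction field [F] of the power series
    ring in the role of differentials. Only the diagonal of the exponential
    matters: its entries are the exponentials of the [f j].

    Let [x 1], ..., [x N] be integer combinations of the [f j] that are linearly
    independent over the rationals, and [y i] the exponential of [x i], a monomial
    in the diagonal entries of the exponential matrix. If [b] is a transcendence
    basis of the field in question, a derivation of [F] that kills the constants
    and [b] kills this whole field ([derivation_transcendence_basis]). So the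
    length of [b] is at least the dimension of any space of derivations that
    restricts injectively to the field. The partial derivatives contribute the
    rank of the Jacobian; they are all killed by the [N] forms
    [D |-> D (y i) / y i - D (x i)]. If these forms are linearly independent, [N]
    more independent derivations exist, and the bound follows ([ax_schanuel]).

    The independence of the forms is the heart of the matter ([dlog_sub_free]).
    Their Lie derivatives along the partial derivatives vanish, so a linear
    relation between them may be taken with constant coefficients [c i]
    ([constant_vector]). Choose integers [m i] that satisfy all the rational
    linear relations of the [c i]. The product [z] of the [y i ^ m i] is the
    exponential of the non-constant series [\sum_i m i * x i], hence is
    transcendental over the constants. A residue computation at [z = 0] excludes
    this situation ([dlog_independent]): take a maximal ring [k] of coefficients
    over which [z] is transcendental, so that all of [F] is algebraic over
    [k(z)]; extend [z d/dz] to a derivation of [F] that kills [k]; descend to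
    [k(z)] by norms and traces ([trace_dlog]); and compare constant terms
    ([ratfun_residue]). Derivations are extended by Zorn's lemma
    ([derivation_extension]). *)

Set Implicit Arguments.
Unset Strict Implicit.
Unset Printing Implicit Defensive.

Import Order.TTheory GRing.Theory Num.Theory.

Local Open Scope ring_scope.
Local Open Scope classical_set_scope.
Local Open Scope complex_scope.

(** * Subfields as field types *)

Section Subfield.
Variables (F : fieldType) (S : divringClosed F).

(** A type for the subfield [S]: the theory of algebraic elements and the
    primitive element theorem want the base field to be a type. *)
Record subfield := Subfield { subfield_val :> F; _ : subfield_val \in S }.

HB.instance Definition _ := [isSub for subfield_val].
HB.instance Definition _ := [Choice of subfield by <:].
HB.instance Definition _ := [SubChoice_isSubIntegralDomain of subfield by <:].
HB.instance Definition _ := [SubIntegralDomain_isSubField of subfield by <:].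

Definition sfval : {rmorphism subfield -> F} := \val.

Lemma sfvalP (x : subfield) : sfval x \in S.
Proof. exact: valP. Qed.

Lemma sfval_surj x : x \in S -> exists y, x = sfval y.
Proof. by move=> Sx; exists (Subfield Sx). Qed.

Lemma poly_over_subfield (p : {poly F}) :
  (forall i, p`_i \in S) -> exists q, p = map_poly sfval q.
Proof.
move=> Sp; exists (\poly_(i < size p) Subfield (Sp i)).
apply/polyP => i; rewrite coef_map coef_poly.
by case: ltnP => [//|le_pi]; rewrite nth_default.
Qed.

Lemma algebraicOverP x : algebraicOver sfval x <->
  exists p : {poly F}, [/\ p != 0, forall i, p`_i \in S & root p x].
Proof.
split=> [[p p0 px]|[p [p0 Sp px]]].
  exists (map_poly sfval p); split=> //; first by rewrite map_poly_eq0.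
  by move=> i; rewrite coef_map sfvalP.
have [q Eq] := poly_over_subfield Sp.
by exists q; rewrite -?Eq // -(map_poly_eq0 sfval) -Eq.
Qed.

End Subfield.

Lemma divring_closedP (F : fieldType) (S : {pred F}) :
  GRing.divring_closed S -> exists T : divringClosed F, T =i S.
Proof.
move=> H.
by exists (HB.pack_for (divringClosed F) S (GRing.isDivringClosed.Build F S H)).
Qed.

(** * Derivations of a field *)

Section Derivation.
Variable F : fieldType.
Implicit Types (D : F -> F) (u v w : F) (p q : {poly F}).

Definition derivation D :=
  (forall u v, D (u + v) = D u + D v) /\
  (forall u v, D (u * v) = D u * v + u * D v).

Section Theory.
Variable D : F -> F.
Hypothesis derD : derivation D.

Lemma derivationD u v : D (u + v) = D u + D v. Proof. exact: derD.1. Qed.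
Lemma derivationM u v : D (u * v) = D u * v + u * D v.
Proof. exact: derD.2. Qed.
Lemma derivation0 : D 0 = 0.
Proof. by apply: (addrI (D 0)); rewrite -derivationD !addr0. Qed.
Lemma derivationN u : D (- u) = - D u.
Proof. by apply/eqP; rewrite -addr_eq0 -derivationD addNr derivation0. Qed.
Lemma derivationB u v : D (u - v) = D u - D v.
Proof. by rewrite derivationD derivationN. Qed.
Lemma derivation1 : D 1 = 0.
Proof.
by apply: (addrI (D 1)); rewrite addr0 -{3}[1]mulr1 derivationM mulr1 mul1r.
Qed.
Lemma derivation_sum (I : Type) (r : seq I) (P : pred I) (E : I -> F) :
  D (\sum_(i <- r | P i) E i) = \sum_(i <- r | P i) D (E i).
Proof. exact: (big_morph _ derivationD derivation0). Qed.
Lemma derivationMn u n : D (u *+ n) = D u *+ n.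
Proof.
by elim: n => [|n IH]; rewrite ?mulr0n ?derivation0 // !mulrS derivationD IH.
Qed.
Lemma derivationMz u (n : int) : D (u *~ n) = D u *~ n.
Proof.
by case: n => n; rewrite ?NegzE ?mulrNz ?derivationN -!pmulrn derivationMn.
Qed.
Lemma derivation_int (n : int) : D n%:~R = 0.
Proof. by rewrite derivationMz derivation1 mul0rz. Qed.
Lemma derivationV u : D u^-1 = - D u / u ^+ 2.
Proof.
have [->|u0] := eqVneq u 0; first by rewrite invr0 derivation0 oppr0 mul0r.
have /eqP : D (u^-1 * u) = 0 by rewrite mulVf // derivation1.
rewrite derivationM addr_eq0 => /eqP H.
by apply: (mulIf u0); rewrite H; field.
Qed.
Lemma derivationXn u n : D (u ^+ n) = u ^+ n.-1 * D u *+ n.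
Proof.
elim: n => [|n IH]; first by rewrite expr0 derivation1.
rewrite exprS derivationM IH /= mulrS [in LHS]mulrC; congr (_ + _).
by case: n {IH} => [|n] /=; rewrite ?mulr0 // mulrnAr mulrA exprS.
Qed.

Lemma dlogM u v : u != 0 -> v != 0 ->
  D (u * v) / (u * v) = D u / u + D v / v.
Proof.
by move=> u0 v0; rewrite derivationM; field; rewrite u0 v0.
Qed.
Lemma dlogV u : D u^-1 / u^-1 = - (D u / u).
Proof.
have [->|u0] := eqVneq u 0; first by rewrite invr0 derivation0 !mul0r oppr0.
by rewrite derivationV invrK; field; rewrite u0.
Qed.
Lemma dlogXn u n : u != 0 -> D (u ^+ n) / u ^+ n = (D u / u) *+ n.
Proof.
move=> u0; elim: n => [|n IH]; first by rewrite derivation1 mul0r.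
by rewrite exprS dlogM ?expf_neq0 // IH mulrS.
Qed.
Lemma dlogXz u (n : int) : u != 0 -> D (u ^ n) / u ^ n = (D u / u) *~ n.
Proof.
move=> u0; case: n => n; first by rewrite -pmulrn -exprnP dlogXn.
by rewrite NegzE -invr_expz dlogV mulrNz -pmulrn -exprnP dlogXn.
Qed.
Lemma dlog_prod (I : finType) (E : I -> F) : (forall i, E i != 0) ->
  D (\prod_i E i) / (\prod_i E i) = \sum_i D (E i) / E i.
Proof.
move=> E0; suff [] : \prod_i E i != 0 /\
    D (\prod_i E i) / (\prod_i E i) = \sum_i D (E i) / E i by [].
apply: (big_rec2 (fun x y => x != 0 /\ D x / x = y)).
  by rewrite derivation1 mul0r oner_neq0.
by move=> i y x _ [x0 <-]; rewrite mulf_neq0 // dlogM.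
Qed.

Lemma derivation_horner p w :
  D p.[w] = (\poly_(i < size p) D p`_i).[w] + p^`().[w] * D w.
Proof.
rewrite horner_coef horner_poly derivation_sum.
have -> : p^`().[w] = \sum_(i < size p) p`_i * w ^+ i.-1 *+ i.
  have [->|p0] := eqVneq p 0; first by rewrite derivC horner0 size_poly0 big_ord0.
  have sp : size p = (size p).-1.+1 by rewrite prednK // lt0n size_poly_eq0.
  rewrite sp big_ord_recl mulr0n add0r.
  rewrite (@horner_coef_wide _ (size p).-1); last by rewrite -ltnS -sp lt_size_deriv.
  by apply: eq_bigr => i _; rewrite coef_deriv mulrnAl.
rewrite mulr_suml -big_split /=; apply: eq_bigr => i _.
by rewrite derivationM derivationXn mulrnAr mulrnAl mulrA.
Qed.

Lemma derivation_kernel : GRing.divring_closed [pred u | D u == 0].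
Proof.
split=> [|u v|u v]; rewrite !inE ?derivation1 // => /eqP u0 /eqP v0.
  by rewrite derivationB u0 v0 subr0.
by rewrite derivationM derivationV u0 v0 oppr0 !mul0r mulr0 addr0.
Qed.

End Theory.

Lemma derivation_sumZ (I : finType) (a : I -> F) (D : I -> F -> F) :
    (forall i, derivation (D i)) ->
  derivation (fun u => \sum_i a i * D i u).
Proof.
move=> derD; split=> u v.
  by rewrite -big_split; apply: eq_bigr => i _; rewrite (derivationD (derD i)) mulrDr.
rewrite mulr_suml mulr_sumr -big_split; apply: eq_bigr => i _ /=.
by rewrite (derivationM (derD i)); ring.
Qed.

Lemma derivation_bracket D D' : derivation D -> derivation D' ->
  derivation (fun u => D (D' u) - D' (D u)).
Proof.
move=> [DD DM] [D'D D'M]; split=> u v; first by rewrite !(DD, D'D); ring.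
by rewrite !(DM, D'M, DD, D'D); ring.
Qed.

End Derivation.

Section Char0.
Variables (F : fieldType) (char0 : [pchar F] =i pred0).
Implicit Types (D : F -> F) (u v w : F) (p q r : {poly F}).

Lemma deriv_neq0 p : (1 < size p)%N -> p^`() != 0.
Proof.
move=> p1; apply/eqP => /(congr1 (fun q : {poly F} => q`_((size p).-2))) /eqP.
rewrite coef_deriv coef0 -mulr_natr mulf_eq0.
have -> : (size p).-2.+1 = (size p).-1 by case: (size p) p1 => [|[]].
rewrite -lead_coefE lead_coef_eq0 -size_poly_eq0.
rewrite (proj1 (pcharf0P F) char0) ?eqn0Ngt.
by case: (size p) p1 => [|[]].
Qed.

(** Among the polynomials of a class stable under derivation that vanish at
    [w], one of least degree has a non-zero derivative at [w], for the derivative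
    of a non-constant polynomial is a non-zero polynomial of smaller degree. *)
Lemma min_root_separable (P : {poly F} -> Prop) w :
    (forall p, P p -> P p^`()) ->
    (exists p, [/\ p != 0, P p & p.[w] = 0]) ->
  exists p, [/\ p != 0, P p, p.[w] = 0, p^`().[w] != 0 &
    forall q, P q -> q.[w] = 0 -> (size q < size p)%N -> q = 0].
Proof.
move=> Pder [p [p0 Pp pw]].
pose Q n := `[< exists p, [/\ size p = n, p != 0, P p & p.[w] = 0] >].
have exQ : exists n, Q n by exists (size p); apply/asboolP; exists p.
case: (ex_minnP exQ) => n /asboolP[{Pp pw p0}p [sp p0 Pp pw]] minn.
have minp q : P q -> q.[w] = 0 -> (size q < size p)%N -> q = 0.
  move=> Pq qw; rewrite ltnNge => lt_qp; apply/eqP; apply: contraNT lt_qp => q0.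
  by rewrite sp minn //; apply/asboolP; exists q.
have p1 : (1 < size p)%N.
  rewrite ltnNge; apply/negP => /size1_polyC Ep; case/eqP: p0.
  by move: pw; rewrite Ep hornerC => ->.
exists p; split=> //; apply/eqP => /(minp _ (Pder _ Pp)) H.
have /eqP := deriv_neq0 p1; apply; apply: H; exact: lt_size_deriv.
Qed.

(** Differentiating an equation [p.[w] = 0] with coefficients in the kernel
    gives [p^`().[w] * D w = 0]; take [p] of least degree. *)
Lemma derivation_algebraic D (S : {pred F}) w : derivation D ->
    (forall u, u \in S -> D u = 0) ->
    (forall u n, u \in S -> u *+ n \in S) ->
    (exists p, [/\ p != 0, forall i, p`_i \in S & root p w]) ->
  D w = 0.
Proof.
move=> derD DS SMn [p0 [np0 Sp0 /rootP p0w]].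
pose P p := forall i, p`_i \in S.
have Pder p : P p -> P p^`() by move=> Sp i; rewrite coef_deriv SMn.
have exP : exists p, [/\ p != 0, P p & p.[w] = 0] by exists p0.
have [p [p_n0 Sp pw p'w _]] := min_root_separable Pder exP.
have := derivation_horner derD p w; rewrite pw (derivation0 derD).
have -> : \poly_(i < size p) D p`_i = 0.
  by apply/polyP => i; rewrite coef_poly coef0 DS //; case: ltnP.
by rewrite horner0 add0r => /esym/eqP; rewrite mulf_eq0 (negPf p'w) => /eqP.
Qed.

End Char0.

(** * Extension of derivations *)

Section DerivationGraph.
Variable F : fieldType.
Implicit Types (G : set (F * F)) (u v w a b : F) (p q r s : {poly F}).

(** The graph of a derivation from a subring of [F] to [F]. The last clause says
    that this set of pairs is functional, since it is stable under differences. *)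
Definition derivation_graph G :=
  [/\ G (1, 0),
      forall u a v b, G (u, a) -> G (v, b) -> G (u - v, a - b),
      forall u a v b, G (u, a) -> G (v, b) -> G (u * v, a * v + u * b) &
      forall a, G (0, a) -> a = 0].

(** [r] is obtained from [p] by differentiating its coefficients. *)
Definition graph_poly G p r := forall i, G (p`_i, r`_i).

(** The value forced on the derivative of [p.[w]] when [w] has derivative [a]. *)
Definition slope w a p r : F := r.[w] + p^`().[w] * a.

Definition graph_compat G w a :=
  forall p r, graph_poly G p r -> p.[w] = 0 -> slope w a p r = 0.

(** The graph extended to the field of fractions of the polynomials in [w], with
    [a] as the derivative of [w]. *)
Definition graph_adjoin G w a : set (F * F) := [set x |
  exists p r q s, [/\ graph_poly G p r, graph_poly G q s, q.[w] != 0,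
    x.1 = p.[w] / q.[w] &
    x.2 = (slope w a p r * q.[w] - p.[w] * slope w a q s) / q.[w] ^+ 2]].

Lemma slopeB w a p r q s :
  slope w a (p - q) (r - s) = slope w a p r - slope w a q s.
Proof. by rewrite /slope derivB !hornerE; ring. Qed.

Lemma slopeM w a p r q s : slope w a (p * q) (r * q + p * s) =
  slope w a p r * q.[w] + p.[w] * slope w a q s.
Proof. by rewrite /slope derivM !hornerE; ring. Qed.

Lemma slopeC w a u b : slope w a u%:P b%:P = b.
Proof. by rewrite /slope derivC horner0 hornerC mul0r addr0. Qed.

Section GraphTheory.
Variable G : set (F * F).
Hypothesis graphG : derivation_graph G.

Lemma graph1 : G (1, 0). Proof. by case: graphG. Qed.
Lemma graphB u a v b : G (u, a) -> G (v, b) -> G (u - v, a - b).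
Proof. by case: graphG => _ h _ _; apply: h. Qed.
Lemma graphM u a v b : G (u, a) -> G (v, b) -> G (u * v, a * v + u * b).
Proof. by case: graphG => _ _ h _; apply: h. Qed.
Lemma graph_fun a : G (0, a) -> a = 0.
Proof. by case: graphG => _ _ _; apply. Qed.
Lemma graph0 : G (0, 0).
Proof. by have := graphB graph1 graph1; rewrite !subrr. Qed.
Lemma graphN u a : G (u, a) -> G (- u, - a).
Proof. by move=> /(graphB graph0); rewrite !sub0r. Qed.
Lemma graphD u a v b : G (u, a) -> G (v, b) -> G (u + v, a + b).
Proof. by move=> Gu /graphN /(graphB Gu); rewrite !opprK. Qed.
Lemma graphMn u a n : G (u, a) -> G (u *+ n, a *+ n).
Proof.
move=> Gu; elim: n => [|n IH]; first by rewrite !mulr0n; exact: graph0.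
by rewrite !mulrS; apply: graphD.
Qed.
Lemma graph_sum (I : Type) (t : seq I) (f g : I -> F) :
  (forall i, G (f i, g i)) -> G (\sum_(i <- t) f i, \sum_(i <- t) g i).
Proof.
move=> Gfg; elim: t => [|i t IH]; first by rewrite !big_nil; exact: graph0.
by rewrite !big_cons; apply: graphD.
Qed.

Lemma graph_polyB p r q s : graph_poly G p r -> graph_poly G q s ->
  graph_poly G (p - q) (r - s).
Proof. by move=> Gp Gq i; rewrite !coefB; apply: graphB. Qed.
Lemma graph_polyM p r q s : graph_poly G p r -> graph_poly G q s ->
  graph_poly G (p * q) (r * q + p * s).
Proof.
move=> Gp Gq i; rewrite coefD !coefM -big_split.
by apply: graph_sum => j; apply: graphM.
Qed.
Lemma graph_polyC u a : G (u, a) -> graph_poly G u%:P a%:P.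
Proof. by move=> Gu i; rewrite !coefC; case: eqP => // _; exact: graph0. Qed.
Lemma graph_polyXn n : graph_poly G 'X^n 0.
Proof.
by move=> i; rewrite coefXn coef0; case: eqP => _; [exact: graph1|exact: graph0].
Qed.
Lemma graph_poly_deriv p r : graph_poly G p r -> graph_poly G p^`() r^`().
Proof. by move=> Gp i; rewrite !coef_deriv; apply: graphMn. Qed.
Lemma graph_poly_fun r : graph_poly G 0 r -> r = 0.
Proof.
by move=> G0; apply/polyP => i; have := G0 i; rewrite !coef0 => /graph_fun.
Qed.

Lemma adjoin_incl w a : G `<=` graph_adjoin G w a.
Proof.
move=> [u b] Gu; exists u%:P, b%:P, 1%:P, 0%:P.
split; [exact: graph_polyC|exact: (graph_polyC graph1)| | |];
  by rewrite ?slopeC ?hornerC ?oner_neq0 ?divr1 //= expr1n divr1 mulr1 mulr0 subr0.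
Qed.

Lemma adjoin_gen w a : graph_adjoin G w a (w, a).
Proof.
exists 'X^1, 0, 1%:P, 0%:P.
split; [exact: graph_polyXn|exact: (graph_polyC graph1)| | |].
- by rewrite hornerC oner_neq0.
- by rewrite hornerC divr1 hornerXn.
- rewrite slopeC hornerC expr1n divr1 mulr1 mulr0 subr0.
  by rewrite /slope derivXn /= horner0 add0r hornerMn expr0 hornerC mul1r.
Qed.

Lemma adjoin_graph w a : graph_compat G w a ->
  derivation_graph (graph_adjoin G w a).
Proof.
move=> compat; split; first exact: adjoin_incl graph1.
- move=> u1 a1 u2 a2 [p [r [q [s [Gp Gq q0 /= -> ->]]]]].
  move=> [p' [r' [q' [s' [Gp' Gq' q'0 /= -> ->]]]]].
  have A := graph_polyM Gp Gq'; have B := graph_polyM Gp' Gq.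
  have Q := graph_polyM Gq Gq'.
  exists (p * q' - p' * q), ((r * q' + p * s') - (r' * q + p' * s)), (q * q'),
    (s * q' + q * s'); split=> //=.
  + exact: graph_polyB.
  + by rewrite hornerM mulf_neq0.
  + by rewrite !hornerE /=; field; rewrite q0 q'0.
  + by rewrite slopeB !slopeM !hornerE /=; field; rewrite q0 q'0.
- move=> u1 a1 u2 a2 [p [r [q [s [Gp Gq q0 /= -> ->]]]]].
  move=> [p' [r' [q' [s' [Gp' Gq' q'0 /= -> ->]]]]].
  have A := graph_polyM Gp Gp'; have Q := graph_polyM Gq Gq'.
  exists (p * p'), (r * p' + p * r'), (q * q'), (s * q' + q * s'); split=> //=.
  + by rewrite hornerM mulf_neq0.
  + by rewrite !hornerE /=; field; rewrite q0 q'0.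
  + by rewrite !slopeM !hornerE /=; field; rewrite q0 q'0.
- move=> b [p [r [q [s [Gp Gq q0 /= E ->]]]]].
  have pw : p.[w] = 0.
    by apply/eqP; move/esym/eqP: E; rewrite mulf_eq0 invr_eq0 (negPf q0) orbF.
  by rewrite pw (compat _ _ Gp pw) !mul0r subrr mul0r.
Qed.

(** Either [w] satisfies no equation over the domain of the graph, and its
    derivative may be chosen at will, or the equation [p.[w] = 0] of least
    degree forces it; every other equation of [w] reduces to that one by
    pseudo-division. *)
Lemma exists_compat w : [pchar F] =i pred0 -> exists a, graph_compat G w a.
Proof.
move=> char0; pose P p := exists r, graph_poly G p r.
have Pder p : P p -> P p^`() by case=> r Gp; exists r^`(); exact: graph_poly_deriv.
have [exP|noP] := pselect (exists p, [/\ p != 0, P p & p.[w] = 0]); last first.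
  exists 0 => p r Gp pw; have [p0|p0] := eqVneq p 0.
    rewrite p0 in Gp *; rewrite (graph_poly_fun Gp) /slope.
    by rewrite linear0 !horner0 mul0r addr0.
  by case: noP; exists p; split=> //; exists r.
have [p [p0 [r Gp] pw p'w minp]] := min_root_separable char0 Pder exP.
pose a := - r.[w] / p^`().[w].
have slp : slope w a p r = 0 by rewrite /slope /a mulrCA mulfV // mulr1 subrr.
exists a => f g; have [n le_n] := ubnP (size f).
elim: n f g le_n => // n IH f g le_n Gf fw.
have [lt_fp|le_pf] := ltnP (size f) (size p).
  have f0 : f = 0 by apply: minp => //; exists g.
  rewrite f0 in Gf *; rewrite (graph_poly_fun Gf) /slope.
  by rewrite linear0 !horner0 mul0r addr0.
(* Cancel the leading term of f by a multiple of p: as p.[w] and its slope vanish,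
   the slope of f is multiplied by lead_coef p. *)
pose m := (size f - size p)%N.
have Gcf : graph_poly G (f`_(size f).-1)%:P (g`_(size f).-1)%:P.
  exact: graph_polyC.
have Gcp : graph_poly G (p`_(size p).-1)%:P (r`_(size p).-1)%:P.
  exact: graph_polyC.
have A := graph_polyM Gcp Gf.
have B := graph_polyM (graph_polyM Gcf (graph_polyXn m)) Gp.
have AB := graph_polyB A B.
have sp : (0 < size p)%N by rewrite size_poly_gt0.
have f0 : f != 0 by rewrite -size_poly_gt0 (leq_trans _ le_pf) // size_poly_gt0.
have sf : (size f = (size f).-1.+1)%N by rewrite prednK // size_poly_gt0.
have cf : lead_coef p * lead_coef f != 0 by rewrite mulf_neq0 ?lead_coef_eq0.
set fcf := _ - _ in AB; have lt_n : (size fcf < n)%N.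
  move: le_n; rewrite ltnS sf; apply: leq_trans; rewrite ltnS.
  apply/leq_sizeP => j le_j; rewrite coefB coefCM -mulrA coefCM coefXnM.
  have -> : (j < m)%N = false by apply/negbTE; rewrite -leqNgt /m; lia.
  have [<-|lt_j] := eqVneq (size f).-1 j.
    have -> : ((size f).-1 - m = (size p).-1)%N by rewrite /m; lia.
    by rewrite mulrC subrr.
  have lt_fj : (size f <= j)%N by rewrite sf ltn_neqAle lt_j.
  have lt_pj : (size p <= j - m)%N by rewrite /m; lia.
  rewrite (nth_default 0 lt_fj) (nth_default 0 lt_pj).
  by rewrite !mulr0 subrr.
have fcfw : fcf.[w] = 0 by rewrite !hornerE fw pw !mulr0 subrr.
have := IH _ _ lt_n AB fcfw; rewrite slopeB !slopeM slp fw pw.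
rewrite hornerC !(mulr0, add0r, subr0, mul0r) => /eqP.
by rewrite mulf_eq0 -lead_coefE lead_coef_eq0 (negPf p0) => /eqP.
Qed.

End GraphTheory.

(** By Zorn's lemma it suffices to extend a graph to one more element, which
    [exists_compat] allows. *)
Theorem derivation_extension G : [pchar F] =i pred0 -> derivation_graph G ->
  exists D, derivation D /\ forall x, G x -> D x.1 = x.2.
Proof.
move=> char0 graphG.
(* The empty set is admitted for the sake of the empty chain. *)
pose P (H : set (F * F)) := H = set0 \/ (G `<=` H /\ derivation_graph H).
have [] := @Zorn_bigcup _ P.
  move=> C CP totC; have [[H [CH H0]]|noH] := pselect (exists H, C H /\ H != set0);
    last first.
    left; apply/seteqP; split=> // x [H CH Hx]; apply: noH; exists H; split=> //.
    by apply/eqP => H0; rewrite H0 in Hx.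
  have good X x : C X -> X x -> G `<=` X /\ derivation_graph X.
    by move=> /CP[->|//].
  have join X Y x y : C X -> C Y -> X x -> Y y ->
      exists Z, [/\ C Z, Z x, Z y & derivation_graph Z].
    move=> CX CY Xx Yy; case: (totC X Y CX CY) => XY.
      by exists Y; split=> //; [exact: XY|exact: (good _ _ CY Yy).2].
    by exists X; split=> //; [exact: XY|exact: (good _ _ CX Xx).2].
  have /set0P[h0 Hh0] := H0; have [GH gH] := good _ _ CH Hh0.
  right; split; first by move=> x /GH Hx; exists H.
  split; first by exists H => //; exact: graph1.
  - move=> u a v b [X CX Xu] [Y CY Yv].
    have [Z [CZ Zu Zv gZ]] := join _ _ _ _ CX CY Xu Yv.
    by exists Z => //; exact: graphB.
  - move=> u a v b [X CX Xu] [Y CY Yv].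
    have [Z [CZ Zu Zv gZ]] := join _ _ _ _ CX CY Xu Yv.
    by exists Z => //; exact: graphM.
  - by move=> a [X CX Xa]; have [_ gX] := good _ _ CX Xa; exact: (graph_fun gX).
move=> H [PH maxH].
have {PH} [GH graphH] : G `<=` H /\ derivation_graph H.
  case: PH => // H0; exfalso; apply: (maxH G); last by right; split.
  rewrite H0; split; first exact: sub0set.
  by move=> /(_ _ (graph1 graphG)).
have total w : exists a, H (w, a).
  have [a compat] := exists_compat graphH w char0; exists a.
  apply: contrapT => nHw; apply: (maxH (graph_adjoin H w a)).
    split; first exact: adjoin_incl.
    by move=> /(_ _ (adjoin_gen graphH w a)).
  right; split; last exact: adjoin_graph.
  by apply: (subset_trans GH); exact: adjoin_incl.
have [D HD] := choice total.
have func u a b : H (u, a) -> H (u, b) -> a = b.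
  move=> Ha Hb; have := graphB graphH Ha Hb; rewrite subrr => /(graph_fun graphH).
  by move/eqP; rewrite subr_eq0 => /eqP.
exists D; split; last by move=> [u a] /GH /(func _ _ _ (HD u)).
split=> u v; apply: func (HD _) _; [exact: graphD|exact: graphM].
Qed.

End DerivationGraph.

(** * Coefficient rings of a transcendental element *)

Section CoefficientRing.
Variable F : fieldType.
Implicit Types (k C : set F) (p q : {poly F}) (u v w z : F).

Definition subring_set k :=
  [/\ k 1, forall u v, k u -> k v -> k (u - v) &
      forall u v, k u -> k v -> k (u * v)].

Definition coefs_in k p := forall i, k p`_i.

Definition transcendental k z := forall p, coefs_in k p -> p.[z] = 0 -> p = 0.

Section SubringTheory.
Variable k : set F.
Hypothesis ringk : subring_set k.

Lemma subring1 : k 1. Proof. by case: ringk. Qed.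
Lemma subringB u v : k u -> k v -> k (u - v). Proof. by case: ringk => _ h _; apply: h. Qed.
Lemma subringM u v : k u -> k v -> k (u * v). Proof. by case: ringk => _ _; apply. Qed.
Lemma subring0 : k 0. Proof. by have := subringB subring1 subring1; rewrite subrr. Qed.
Lemma subringN u : k u -> k (- u). Proof. by move=> /(subringB subring0); rewrite sub0r. Qed.
Lemma subringD u v : k u -> k v -> k (u + v).
Proof. by move=> ku /subringN /(subringB ku); rewrite opprK. Qed.
Lemma subringMn u n : k u -> k (u *+ n).
Proof.
by move=> ku; elim: n => [|n IH]; [exact: subring0|rewrite mulrS; apply: subringD].
Qed.
Lemma subring_int (n : int) : k n%:~R.
Proof.
case: n => n; first by rewrite -pmulrn; exact/subringMn/subring1.
by rewrite NegzE mulrNz -pmulrn; exact/subringN/subringMn/subring1.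
Qed.
Lemma subring_sum (I : Type) (t : seq I) (P : pred I) (f : I -> F) :
  (forall i, P i -> k (f i)) -> k (\sum_(i <- t | P i) f i).
Proof. by move=> kf; apply: big_ind => //; [exact: subring0|exact: subringD]. Qed.

Lemma coefsC u : k u -> coefs_in k u%:P.
Proof. by move=> ku i; rewrite coefC; case: eqP => _ //; exact: subring0. Qed.
Lemma coefsB p q : coefs_in k p -> coefs_in k q -> coefs_in k (p - q).
Proof. by move=> kp kq i; rewrite coefB; apply: subringB. Qed.
Lemma coefsD p q : coefs_in k p -> coefs_in k q -> coefs_in k (p + q).
Proof. by move=> kp kq i; rewrite coefD; apply: subringD. Qed.
Lemma coefsM p q : coefs_in k p -> coefs_in k q -> coefs_in k (p * q).
Proof. by move=> kp kq i; rewrite coefM; apply: subring_sum => j _; apply: subringM. Qed.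
Lemma coefsXn n : coefs_in k 'X^n.
Proof. by move=> i; rewrite coefXn; apply/subringMn/subring1. Qed.
Lemma coefs_deriv p : coefs_in k p -> coefs_in k p^`().
Proof. by move=> kp i; rewrite coef_deriv; apply: subringMn. Qed.

Lemma evals_subring w : subring_set [set p.[w] | p in coefs_in k].
Proof.
split; first by exists 1%:P; [exact/coefsC/subring1|rewrite hornerC].
  move=> _ _ [p kp <-] [q kq <-]; exists (p - q); first exact: coefsB.
  by rewrite hornerD hornerN.
move=> _ _ [p kp <-] [q kq <-]; exists (p * q); first exact: coefsM.
by rewrite hornerM.
Qed.

End SubringTheory.

(** A maximal subring [k] over which [z] stays transcendental plays the role of
    the field of constants of a rational function field in [z]: adjoining any
    [w] to [k] produces an equation between [w] and [z], hence [w] is algebraic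
    over [k[z]]. *)
Lemma exists_coefficient_ring C z : subring_set C -> transcendental C z ->
  exists k, [/\ subring_set k, C `<=` k, transcendental k z &
    forall w, exists p, [/\ p != 0, p.[w] = 0 &
      coefs_in [set q.[z] | q in coefs_in k] p]].
Proof.
move=> ringC transC.
(* The empty set is admitted for the sake of the empty chain. *)
pose P k := k = set0 \/ [/\ subring_set k, C `<=` k & transcendental k z].
have [] := @Zorn_bigcup _ P.
  move=> E EP totE; have [[H [EH H0]]|noH] := pselect (exists H, E H /\ H != set0);
    last first.
    left; apply/seteqP; split=> // x [H EH Hx]; apply: noH; exists H; split=> //.
    by apply/eqP => H0; rewrite H0 in Hx.
  have good X x : E X -> X x ->
    [/\ subring_set X, C `<=` X & transcendental X z] by move=> /EP[->|//].
  have join X Y x y : E X -> E Y -> X x -> Y y ->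
      exists Z, [/\ E Z, Z x, Z y & X `<=` Z /\ subring_set Z].
    move=> EX EY Xx Yy; case: (totE X Y EX EY) => XY.
      by exists Y; split=> //; [exact: XY|split=> //; case: (good _ _ EY Yy)].
    by exists X; split=> //; [exact: XY|split=> //; case: (good _ _ EX Xx)].
  have /set0P[h0 Hh0] := H0; have [ringH CH transH] := good _ _ EH Hh0.
  right; split; last 1 first.
  - move=> p Up pz.
    have [Z [EZ Z1 Zp]] : exists Z, [/\ E Z, Z 1 & coefs_in Z p].
      suff [Z [EZ Z1 Zp]] : exists Z, [/\ E Z, Z 1 &
          forall i, (i < size p)%N -> Z p`_i].
        have [ringZ _ _] := good _ _ EZ Z1.
        exists Z; split=> // i; case: (ltnP i (size p)) => [/Zp //|le_i].
        by rewrite nth_default //; exact: subring0.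
      elim: (size p) => [|n [Z [EZ Z1 Zn]]]; first by exists H; split=> //; exact: subring1.
      have [Y EY Yn] := Up n.
      have [T [ET T1 Tn [ZT ringT]]] := join _ _ _ _ EZ EY Z1 Yn.
      exists T; split=> // i; rewrite ltnS leq_eqVlt => /predU1P[->//|/Zn].
      exact: ZT.
    by have [_ _ transZ] := good _ _ EZ Z1; exact: transZ.
  - split; first by exists H => //; exact: subring1.
    + move=> u v [X EX Xu] [Y EY Yv].
      have [Z [EZ Zu Zv [_ rZ]]] := join _ _ _ _ EX EY Xu Yv.
      by exists Z => //; exact: subringB.
    + move=> u v [X EX Xu] [Y EY Yv].
      have [Z [EZ Zu Zv [_ rZ]]] := join _ _ _ _ EX EY Xu Yv.
      by exists Z => //; exact: subringM.
  - by move=> x /CH Hx; exists H.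
move=> k [Pk maxk].
have {Pk} [ringk Ck transk] : [/\ subring_set k, C `<=` k & transcendental k z].
  case: Pk => // k0; exfalso; apply: (maxk C); last by right; split.
  by rewrite k0; split; [exact: sub0set|move=> /(_ _ (subring1 ringC))].
exists k; split=> // w; have [kw|nkw] := pselect (k w).
  exists ('X - w%:P); split; first by rewrite polyXsubC_eq0.
    by rewrite hornerXsubC subrr.
  move=> i; have [q kq ->] : exists2 q, coefs_in k q & ('X - w%:P)`_i = q`_i.
    by exists ('X^1 - w%:P) => //; apply: coefsB => //; [exact: coefsXn|exact: coefsC].
  by exists (q`_i)%:P; [exact: coefsC|rewrite hornerC].
have [Q [kQ Qz Q0]] : exists Q,
    [/\ coefs_in [set p.[w] | p in coefs_in k] Q, Q.[z] = 0 & Q <> 0].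
  apply: contrapT => noQ; apply: (maxk [set p.[w] | p in coefs_in k]).
    split; first by move=> u ku; exists u%:P; [exact: coefsC|rewrite hornerC].
    by move=> subk; apply/nkw/subk; exists 'X^1; [exact: coefsXn|rewrite hornerXn].
  right; split; [exact: evals_subring| |].
    by move=> u /Ck ku; exists u%:P; [exact: coefsC|rewrite hornerC].
  by move=> p kp pz; apply: contrapT => p0; apply: noQ; exists p.
have [A HA] := choice (fun i => let: ex_intro2 p kp pE := kQ i in
   ex_intro (fun p => coefs_in k p /\ p.[w] = Q`_i) p (conj kp pE)).
(* The equation of z over k[w], read as an equation of w over k[z]. *)
exists (\sum_(i < size Q) A i * (z ^+ i)%:P); split.
- have [i0 lt_i0 Ai0] : exists2 i, (i < size Q)%N & A i != 0.
    exists (size Q).-1; first by rewrite ltn_predL size_poly_gt0; apply/eqP.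
    apply/eqP => A0; apply: Q0; apply/eqP; rewrite -lead_coef_eq0 lead_coefE.
    by rewrite -(HA _).2 A0 horner0.
  pose j := (size (A i0)).-1; apply/eqP => /(congr1 (fun p => p`_j)).
  rewrite coef0 coef_sum => sum0.
  have kB : coefs_in k (\poly_(i < size Q) (A i)`_j).
    move=> i; rewrite coef_poly; case: ltnP => _; last exact: subring0.
    exact: (HA i).1.
  have /(transk _ kB)/polyP/(_ i0) : (\poly_(i < size Q) (A i)`_j).[z] = 0.
    by rewrite horner_poly -[RHS]sum0; apply: eq_bigr => i _; rewrite coefMC.
  rewrite coef_poly lt_i0 coef0 => /eqP.
  by rewrite -lead_coefE lead_coef_eq0 (negPf Ai0).
- rewrite horner_sum -[RHS]Qz horner_coef; apply: eq_bigr => i _.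
  by rewrite hornerM hornerC (HA i).2.
- move=> j; exists (\poly_(i < size Q) (A i)`_j).
    move=> i; rewrite coef_poly; case: ltnP => _; last exact: subring0.
    exact: (HA i).1.
  by rewrite horner_poly coef_sum; apply: eq_bigr => i _; rewrite coefMC.
Qed.

End CoefficientRing.

(** * Rational functions and residues *)

Section RationalFunctions.
Variables (F : fieldType) (k : set F) (z : F).
Hypotheses (ringk : subring_set k) (transk : transcendental k z).
Implicit Types (p q : {poly F}) (u v w c : F).

Definition ratfun : {pred F} := fun u =>
  `[< exists p q, [/\ coefs_in k p, coefs_in k q, q.[z] != 0 &
                     u = p.[z] / q.[z]] >].

Lemma ratfunP u : reflect (exists p q, [/\ coefs_in k p, coefs_in k q, q.[z] != 0
  & u = p.[z] / q.[z]]) (u \in ratfun).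
Proof. exact: asboolP. Qed.

Lemma ratfun_eval p : coefs_in k p -> p.[z] \in ratfun.
Proof.
move=> kp; apply/ratfunP; exists p, 1%:P.
by split=> //; [exact: (coefsC ringk (subring1 ringk))|rewrite hornerC oner_neq0|rewrite hornerC divr1].
Qed.

Lemma ratfun_divring : GRing.divring_closed ratfun.
Proof.
split.
- by rewrite -(hornerC 1 z); exact: (ratfun_eval (coefsC ringk (subring1 ringk))).
- move=> _ _ /ratfunP[p [q [kp kq q0 ->]]] /ratfunP[p' [q' [kp' kq' q'0 ->]]].
  apply/ratfunP; exists (p * q' - p' * q), (q * q'); split.
  + by apply: coefsB => //; apply: coefsM.
  + exact: coefsM.
  + by rewrite hornerM mulf_neq0.
  + by rewrite !hornerE /=; field; rewrite q0 q'0.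
- move=> _ _ /ratfunP[p [q [kp kq q0 ->]]] /ratfunP[p' [q' [kp' kq' q'0 ->]]].
  have [p'0|p'0] := eqVneq p'.[z] 0.
    by rewrite p'0 mul0r invr0 mulr0 -(horner0 z); apply: ratfun_eval => i;
       rewrite coef0; exact: subring0.
  apply/ratfunP; exists (p * q'), (q * p'); split; [exact: coefsM|exact: coefsM| |].
  + by rewrite hornerM mulf_neq0.
  + by rewrite !hornerE /=; field; rewrite q0 q'0 p'0.
Qed.

(** Evaluation of a rational function of [z] at [z = 0], as a relation because of
    the poles; the value is unique since [z] is transcendental. *)
Definition specialize u c := exists p q, [/\ coefs_in k p, coefs_in k q, q`_0 != 0,
  u = p.[z] / q.[z] & c = p`_0 / q`_0].

Lemma coefs_horner_neq0 q : coefs_in k q -> q != 0 -> q.[z] != 0.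
Proof. by move=> kq; apply: contra_neq => /(transk kq). Qed.

Lemma coef0_horner_neq0 q : coefs_in k q -> q`_0 != 0 -> q.[z] != 0.
Proof.
by move=> kq q0; apply: coefs_horner_neq0 => //; apply: contra_neq q0 => ->;
   rewrite coef0.
Qed.

Lemma specialize_eval p : coefs_in k p -> specialize p.[z] p`_0.
Proof.
move=> kp; exists p, 1%:P.
split=> //; first exact: (coefsC ringk (subring1 ringk)); rewrite ?hornerC ?coefC ?oner_neq0 ?divr1 //.
Qed.
Lemma specializeC c : k c -> specialize c c.
Proof.
by move=> kc; rewrite -{1}(hornerC c z) -{2}[c](coefC c 0%N);
   exact: (specialize_eval (coefsC ringk kc)).
Qed.
Lemma specializeX n : specialize (z ^+ n.+1) 0.
Proof.
by have := specialize_eval (@coefsXn _ _ ringk n.+1); rewrite hornerXn coefXn.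
Qed.

Lemma specialize_fun u c c' : specialize u c -> specialize u c' -> c = c'.
Proof.
move=> [p [q [kp kq q0 -> ->]]] [p' [q' [kp' kq' q'0 /eqP + ->]]].
have qz := coef0_horner_neq0 kq q0; have qz' := coef0_horner_neq0 kq' q'0.
rewrite eqr_div // -!hornerM -subr_eq0 -hornerN -hornerD => /eqP.
have kB : coefs_in k (p * q' - p' * q) by apply: coefsB => //; apply: coefsM.
move=> /(transk kB)/(congr1 (fun p => p`_0)); rewrite coefB !coef0M coef0.
by move/eqP; rewrite subr_eq0 => /eqP E; apply/eqP; rewrite eqr_div // E.
Qed.

Lemma specializeD u c v d : specialize u c -> specialize v d ->
  specialize (u + v) (c + d).
Proof.
move=> [p [q [kp kq q0 -> ->]]] [p' [q' [kp' kq' q'0 -> ->]]].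
have qz := coef0_horner_neq0 kq q0; have qz' := coef0_horner_neq0 kq' q'0.
exists (p * q' + p' * q), (q * q'); split.
- by apply: coefsD => //; apply: coefsM.
- exact: coefsM.
- by rewrite coef0M mulf_neq0.
- by rewrite !hornerE /=; field; rewrite qz qz'.
- by rewrite coefD !coef0M; field; rewrite q0 q'0.
Qed.
Lemma specializeM u c v d : specialize u c -> specialize v d ->
  specialize (u * v) (c * d).
Proof.
move=> [p [q [kp kq q0 -> ->]]] [p' [q' [kp' kq' q'0 -> ->]]].
have qz := coef0_horner_neq0 kq q0; have qz' := coef0_horner_neq0 kq' q'0.
exists (p * p'), (q * q'); split; [exact: coefsM|exact: coefsM| | |].
- by rewrite coef0M mulf_neq0.
- by rewrite !hornerE /=; field; rewrite qz qz'.
- by rewrite !coef0M; field; rewrite q0 q'0.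
Qed.
Lemma specializeV u c : specialize u c -> c != 0 -> specialize u^-1 c^-1.
Proof.
move=> [p [q [kp kq q0 -> ->]]]; rewrite mulf_eq0 negb_or => /andP[p0 _].
by exists q, p; rewrite !invfM !invrK; split=> //; rewrite mulrC.
Qed.
Lemma specializeXz u c (n : int) : specialize u c -> c != 0 ->
  specialize (u ^ n) (c ^ n).
Proof.
have X m v d : specialize v d -> specialize (v ^+ m) (d ^+ m).
  move=> sv; elim: m => [|m IH]; first exact: (specializeC (subring1 ringk)).
  by rewrite !exprS; apply: specializeM.
move=> su c0; case: n => n; first exact: X.
rewrite NegzE -!invr_expz; apply: specializeV; last by rewrite expf_neq0.
exact: X.
Qed.
Lemma specialize_sum (I : Type) (t : seq I) (f g : I -> F) :
  (forall i, specialize (f i) (g i)) ->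
  specialize (\sum_(i <- t) f i) (\sum_(i <- t) g i).
Proof.
move=> fg; apply: (big_rec2 specialize); first exact: (specializeC (subring0 ringk)).
by move=> i u v _; apply: specializeD.
Qed.

(** Split off the powers of [z] from the numerator and the denominator. *)
Lemma ratfun_factor u : u \in ratfun -> u != 0 ->
  exists (n : int) e c, [/\ u = z ^ n * e, specialize e c & c != 0].
Proof.
have z0 : z != 0.
  apply/eqP => z0; have := transk (@coefsXn _ _ ringk 1); rewrite hornerXn z0.
  by move=> /(_ erefl)/eqP; rewrite polyX_eq0.
have fact p : coefs_in k p -> p != 0 ->
    exists n q, [/\ coefs_in k q, p = q * 'X^n & q`_0 != 0].
  move=> kp p0; have [n [q + Ep]] := multiplicity_XsubC p 0.
  rewrite p0 /= rootE horner_coef0 subr0 in Ep * => q0.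
  exists n, q; split=> // i; have := kp (i + n)%N.
  by rewrite Ep coefMXn ltnNge leq_addl addnK.
move=> /ratfunP[p [q [kp kq qz ->]]]; rewrite mulf_eq0 negb_or => /andP[pz _].
have [|n [p1 [kp1 Ep p10]]] := fact p kp.
  by apply: contra_neq pz => ->; rewrite horner0.
have [|m [q1 [kq1 Eq q10]]] := fact q kq.
  by apply: contra_neq qz => ->; rewrite horner0.
exists (n%:Z - m%:Z), (p1.[z] / q1.[z]), (p1`_0 / q1`_0); split.
- rewrite Ep Eq !hornerM !hornerXn expfzDr // -exprnP -invr_expz -exprnP.
  have q1z := coef0_horner_neq0 kq1 q10.
  by field; rewrite q1z expf_neq0.
- by exists p1, q1.
- by rewrite mulf_neq0 ?invr_eq0.
Qed.

Variable D : F -> F.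
Hypotheses (derD : derivation D) (Dk : forall u, k u -> D u = 0) (Dz : D z = z).

Lemma derivation_eval p : coefs_in k p -> D p.[z] = (p^`() * 'X).[z].
Proof.
move=> kp; rewrite derivation_horner // Dz hornerM hornerX.
have -> : \poly_(i < size p) D p`_i = 0.
  by apply/polyP => i; rewrite coef_poly coef0 Dk //; case: ltnP.
by rewrite horner0 add0r.
Qed.

(** The factor [z] of [z d/dz] appears in the numerator of the derivative. *)
Lemma specialize_derivation u c : specialize u c -> specialize (D u) 0.
Proof.
move=> [p [q [kp kq q0 -> _]]]; have qz := coef0_horner_neq0 kq q0.
exists ((p^`() * q - p * q^`()) * 'X), (q * q); split.
- apply: coefsM => //; last exact: (@coefsXn _ _ ringk 1).
  by apply: coefsB => //; apply: coefsM => //; exact: coefs_deriv.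
- exact: coefsM.
- by rewrite coef0M mulf_neq0.
- rewrite (derivationM derD) (derivationV derD) !derivation_eval // !hornerE /=.
  by field; rewrite qz.
- by rewrite coefMX mul0r.
Qed.

(** Residues at [z = 0]: the constant term of [z d/dz (log u)] is the order of
    [u], and that of an exact derivative vanishes. *)
Lemma ratfun_residue N (c u : 'I_N -> F) (s : F) (m : 'I_N -> int) d :
    [pchar F] =i pred0 ->
    (forall i, k (c i)) -> (forall i, u i \in ratfun) -> (forall i, u i != 0) ->
    s \in ratfun ->
    \sum_i c i * (D (u i) / u i) = D s ->
    \prod_i u i ^ m i = z ^+ d ->
    (forall o : 'I_N -> int, \sum_i c i * (o i)%:~R = 0 ->
       \sum_i m i * o i = 0) ->
  d = 0%N.
Proof.
move=> char0 kc ru u0 rs Es Eu Hm.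
have zz : z != 0.
  apply/eqP => z0; have := transk (@coefsXn _ _ ringk 1); rewrite hornerXn z0.
  by move=> /(_ erefl)/eqP; rewrite polyX_eq0.
have /choice[o Ho] i := ratfun_factor (ru i) (u0 i).
have {Ho} /choice[e He] := Ho.
have {He} /choice[h Hh] := He.
have e0 i : e i != 0.
  by apply: contra_neq (u0 i) => e0; have [-> _ _] := Hh i; rewrite e0 mulr0.
(* D z / z = 1, hence the order o i of u i shows up in its logarithmic derivative. *)
have dlog i : D (u i) / u i = (o i)%:~R + D (e i) / e i.
  have [-> _ _] := Hh i; rewrite dlogM ?expfz_neq0 // dlogXz // Dz divff //.
have spL : specialize (D s) (\sum_i c i * (o i)%:~R).
  rewrite -Es; apply: specialize_sum => i; apply: specializeM.
    exact: specializeC.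
  rewrite dlog -[X in specialize _ X]addr0; apply: specializeD.
    exact: (specializeC (subring_int ringk _)).
  have [_ sh h0] := Hh i; rewrite -(mul0r (h i)^-1); apply: specializeM.
    exact: specialize_derivation sh.
  exact: specializeV.
have spR : specialize (D s) 0.
  have [->|s0] := eqVneq s 0; first by rewrite derivation0 //; exact: (specializeC (subring0 ringk)).
  have [b [t [g [Et st g0]]]] := ratfun_factor rs s0.
  have Ds : D s = z ^ b * (b%:~R * t + D t).
    rewrite Et derivationM //; have := dlogXz derD b zz.
    rewrite Dz divff // => /(canRL (divfK (expfz_neq0 b zz))) ->.
    by ring.
  have sRt : specialize (b%:~R * t + D t) (b%:~R * g).
    rewrite -[X in specialize _ X]addr0; apply: specializeD.
      by apply: specializeM => //; exact: (specializeC (subring_int ringk _)).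
    exact: specialize_derivation st.
  (* b is the order of s at 0; a pole of s would leave the non-zero leading
     coefficient b * g in D s, against spL. *)
  case: b Et Ds sRt => b _ Ds sRt.
    case: b Ds sRt => [|b] Ds sRt; first by rewrite Ds mul1r -(mul0r g).
    by rewrite Ds -(mul0r (b.+1%:~R * g)); apply: specializeM => //; exact: specializeX.
  have : specialize (z ^+ b.+1 * D s) 0.
    by rewrite -(mul0r (\sum_i c i * (o i)%:~R)); apply: specializeM => //;
       exact: specializeX.
  rewrite Ds NegzE -invr_expz mulrA -exprnP mulfV ?expf_neq0 // mul1r.
  move=> /specialize_fun/(_ sRt)/esym/eqP; rewrite NegzE mulrNz mulNr oppr_eq0.
  by rewrite mulf_eq0 (negPf g0) orbF -pmulrn (proj1 (pcharf0P F) char0).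
have /Hm sum0 := specialize_fun spL spR.
(* The powers of z cancel, so z ^+ d is non-zero at 0. *)
have Ee : z ^+ d = \prod_i e i ^ m i.
  rewrite -Eu; transitivity (\prod_i (z ^ (m i * o i) * e i ^ m i)).
    apply: eq_bigr => i _; have [-> _ _] := Hh i.
    by rewrite expfzMl exprz_exp [(m i * _)%R]mulrC.
  rewrite big_split /= -(big_morph (fun n : int => z ^ n)
    (fun a b => expfzDr a b zz) (expr0z z)).
  by rewrite sum0 expr0z mul1r.
have : specialize (z ^+ d) (\prod_i h i ^ m i).
  rewrite Ee; apply: (big_rec2 specialize); first exact: (specializeC (subring1 ringk)).
  move=> i x y _; apply: specializeM; have [_ sh h0] := Hh i.
  exact: specializeXz.
case: d {Eu Ee} => // d /specialize_fun/(_ (specializeX d))/eqP.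
rewrite prodf_seq_eq0 => /hasP[i _ /=]; have [_ _ h0] := Hh i.
by rewrite (negPf (expfz_neq0 _ h0)).
Qed.

End RationalFunctions.

(** * Norms and traces *)

Section Jacobi.
Variables (F : fieldType) (D : F -> F).
Hypothesis derD : derivation D.

Lemma derivation_prod (I : finType) (E : I -> F) :
  D (\prod_i E i) = \sum_i D (E i) * \prod_(j | j != i) E j.
Proof.
suff gen (s : seq I) : uniq s -> D (\prod_(i <- s) E i) =
    \sum_(i <- s) D (E i) * \prod_(j <- s | j != i) E j.
  by rewrite gen ?index_enum_uniq.
elim: s => [|i s IH] /=; first by rewrite !big_nil derivation1.
case/andP=> i_s us; rewrite !big_cons derivationM // IH // eqxx /=.
congr (_ * _ + _).
  rewrite big_seq_cond [RHS]big_seq_cond; apply: eq_bigl => j.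
  by case: eqP => [->|]; rewrite ?andbT ?(negPf i_s).
rewrite mulr_sumr big_seq [RHS]big_seq; apply: eq_bigr => j sj.
rewrite big_cons; case: eqP => [eij|_]; first by rewrite eij sj in i_s.
by rewrite mulrCA.
Qed.

(** Jacobi's formula: by the Leibniz rule the derivative of the determinant is
    the sum over the rows of the determinants with one row differentiated, to be
    expanded along that row. *)
Lemma derivation_det n (A : 'M[F]_n) :
  D (\det A) = \tr (\adj A *m map_mx D A).
Proof.
rewrite mxtrace_mulC [LHS](derivation_sum derD).
have sgn0 (b : bool) : D ((-1) ^+ b) = 0.
  by case: b; rewrite ?expr0 ?expr1 ?derivationN ?derivation1 ?oppr0.
transitivity (\sum_i \det (\matrix_(i', j) if i' == i then D (A i j) else A i' j)).
  rewrite exchange_big /=; apply: eq_bigr => s _.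
  rewrite derivationM // sgn0 mul0r add0r.
  rewrite derivation_prod mulr_sumr; apply: eq_bigr => i _; congr (_ * _).
  rewrite [RHS](bigD1 i) //= !mxE eqxx; congr (_ * _).
  by apply: eq_bigr => j ne; rewrite mxE (negPf ne).
apply: eq_bigr => i _; rewrite (expand_det_row _ i) mxE.
apply: eq_bigr => j _; rewrite !mxE eqxx; congr (_ * _).
rewrite /cofactor; congr (_ * \det _); apply/matrixP => a b; rewrite !mxE.
by rewrite eq_sym (negPf (neq_lift _ _)).
Qed.

Lemma dlog_det n (A : 'M[F]_n) : A \in unitmx ->
  D (\det A) / \det A = \tr (invmx A *m map_mx D A).
Proof.
move=> uA; rewrite derivation_det /invmx uA -scalemxAl mxtraceZ mulrC.
by [].
Qed.

End Jacobi.

Section Representation.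
Variables (K F : fieldType) (iota : {rmorphism K -> F}).
Variables (n : nat) (e : 'cV[F]_n).
Hypothesis free_e : forall r : 'rV[K]_n, map_mx iota r *m e = 0 -> r = 0.
Implicit Types (w : F) (A B : 'M[K]_n).

(** The span of [e] over [K] is stable under multiplication by [w], which has
    matrix [A]. *)
Definition represents w A := w *: e = map_mx iota A *m e.

Lemma free_mx A : map_mx iota A *m e = 0 -> A = 0.
Proof.
move=> A0; apply/row_matrixP => i; rewrite row0; apply: free_e.
by rewrite map_row -row_mul A0 row0.
Qed.

Lemma represents_fun w A B : represents w A -> represents w B -> A = B.
Proof.
rewrite /represents => -> /eqP; rewrite -subr_eq0 -mulmxBl -map_mxB => /eqP/free_mx/eqP.
by rewrite subr_eq0 => /eqP.
Qed.

Lemma represents0 : represents 0 0.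
Proof. by rewrite /represents scale0r map_mx0 mul0mx. Qed.
Lemma representsD w w' A B :
  represents w A -> represents w' B -> represents (w + w') (A + B).
Proof. by rewrite /represents scalerDl map_mxD mulmxDl => -> ->. Qed.
Lemma representsM w w' A B :
  represents w A -> represents w' B -> represents (w * w') (A *m B).
Proof.
rewrite /represents map_mxM -mulmxA => wA <-.
by rewrite -scalemxAr -wA scalerA mulrC.
Qed.
Lemma represents_scalar a : represents (iota a) a%:M.
Proof. by rewrite /represents map_scalar_mx mul_scalar_mx. Qed.

Lemma represents_unit w A : w != 0 -> represents w A -> A \in unitmx.
Proof.
move=> w0 wA; rewrite -row_free_unit -kermx_eq0; apply/eqP.
apply: free_mx; apply: (scalerI w0); rewrite scaler0 scalemxAr wA mulmxA.
by rewrite -map_mxM mulmx_ker map_mx0 mul0mx.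
Qed.
Lemma representsV w A : w != 0 -> represents w A -> represents w^-1 (invmx A).
Proof.
move=> w0 wA; have uA := represents_unit w0 wA.
apply: (scalerI w0); rewrite scalerA mulfV // scale1r scalemxAr wA mulmxA.
by rewrite -map_mxM mulVmx // map_mx1 mul1mx.
Qed.
Lemma represents_sum (I : finType) (w : I -> F) (A : I -> 'M[K]_n) :
  (forall i, represents (w i) (A i)) -> represents (\sum_i w i) (\sum_i A i).
Proof.
move=> wA; apply: (big_rec2 represents); first exact: represents0.
by move=> i x y _; apply: representsD.
Qed.

(** The norm as a relation, for the matrix of an arbitrary [w] need not exist. *)
Definition norm_is w a := exists2 A, represents w A & a = \det A.

Lemma norm_is_fun w a b : norm_is w a -> norm_is w b -> a = b.
Proof. by move=> [A wA ->] [B wB ->]; rewrite (represents_fun wA wB). Qed.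
Lemma norm_is1 : norm_is 1 1.
Proof. by exists 1%:M; rewrite ?det1 // -(rmorph1 iota); exact: represents_scalar. Qed.
Lemma norm_isM w w' a b : norm_is w a -> norm_is w' b -> norm_is (w * w') (a * b).
Proof. by move=> [A wA ->] [B wB ->]; exists (A *m B); rewrite ?det_mulmx //; exact: representsM. Qed.
Lemma norm_isXz w a (m : int) : w != 0 -> norm_is w a -> norm_is (w ^ m) (a ^ m).
Proof.
move=> w0 wa; have X p : norm_is (w ^+ p) (a ^+ p).
  by elim: p => [|p IH]; [exact: norm_is1|rewrite !exprS; exact: norm_isM].
case: m => m; first exact: X.
rewrite NegzE -!invr_expz; have [A wA dA] := X m.+1.
exists (invmx A); first by apply: representsV; rewrite ?expf_neq0.
by rewrite det_inv -dA.
Qed.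

Variables (D : F -> F) (D0 : K -> K).
Hypotheses (derD : derivation D) (DD0 : forall a, D (iota a) = iota (D0 a)).
Variable Gam : 'M[K]_n.
Hypothesis De : map_mx D e = map_mx iota Gam *m e.

Lemma restricted_derivation : derivation D0.
Proof.
by split=> a b; apply: (fmorph_inj iota);
   rewrite -DD0 ?(rmorphD, rmorphM) (derivationD derD, derivationM derD) !DD0.
Qed.

(** Differentiate [w *: e = A *m e]; as [D e = Gam *m e], a commutator
    appears. *)
Lemma represents_derivation w A : represents w A ->
  represents (D w) (map_mx D0 A + (A *m Gam - Gam *m A)).
Proof.
move=> wA.
have E1 : map_mx D (w *: e) = D w *: e + w *: map_mx D e.
  by apply/matrixP => i j; rewrite !mxE derivationM.
have E2 : map_mx D (map_mx iota A *m e) =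
    map_mx iota (map_mx D0 A) *m e + map_mx iota A *m map_mx D e.
  apply/matrixP => i j; rewrite !mxE derivation_sum // -big_split.
  by apply: eq_bigr => l _; rewrite !mxE derivationM // DD0.
rewrite /represents -[D w *: e](addrK (w *: map_mx D e)) -E1 wA E2 De.
rewrite scalemxAr wA !mulmxA -!map_mxM map_mxD map_mxB mulmxDl mulmxBl addrA.
by [].
Qed.

(** Taking traces kills the commutators with [Gam], so that logarithmic
    derivatives of elements become logarithmic derivatives of their norms. *)
Lemma trace_dlog N (c : 'I_N -> K) (y : 'I_N -> F) (A : 'I_N -> 'M[K]_n) v V :
    (forall i, y i != 0) -> (forall i, represents (y i) (A i)) ->
    represents v V ->
    \sum_i iota (c i) * (D (y i) / y i) = D v ->
  \sum_i c i * (D0 (\det (A i)) / \det (A i)) = D0 (\tr V).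
Proof.
move=> y0 yA vV E.
pose T i := invmx (A i) *m (map_mx D0 (A i) + (A i *m Gam - Gam *m A i)).
have repT i : represents (iota (c i) * (D (y i) / y i)) ((c i)%:M *m T i).
  apply: representsM; first exact: represents_scalar.
  rewrite [D _ / _]mulrC; apply: representsM; first exact: representsV.
  exact: represents_derivation.
have := represents_sum repT; rewrite E.
move=> /(represents_fun (represents_derivation vV))/(congr1 mxtrace).
rewrite !linearD linearN /= [\tr (V *m _)]mxtrace_mulC subrr addr0.
rewrite linear_sum /= => trE.
have -> : D0 (\tr V) = \tr (map_mx D0 V).
  by rewrite [LHS](derivation_sum restricted_derivation); apply: eq_bigr => i _;
     rewrite mxE.
rewrite trE; apply: eq_bigr => i _.
rewrite mul_scalar_mx mxtraceZ /T mulmxDr mulmxBr !linearD linearN /=; congr (_ * _).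
have uA := represents_unit (y0 i) (yA i).
rewrite mulKmx // [\tr (invmx _ *m (Gam *m _))]mxtrace_mulC -mulmxA mulmxV //.
by rewrite mulmx1 subrr addr0 dlog_det //; exact: restricted_derivation.
Qed.

End Representation.

(** * Finitely many algebraic elements *)

Section FiniteExtension.
Variables (K F : fieldType) (iota : {rmorphism K -> F}).
Hypothesis char0 : [pchar K] =i pred0.
Local Notation "p ^iota" := (map_poly iota p) (at level 2, format "p ^iota").

Lemma primitive_element N (w : 'I_N -> F) :
    (forall i, algebraicOver iota (w i)) ->
  exists2 t, algebraicOver iota t & forall i, exists q, q^iota.[t] = w i.
Proof.
elim: N w => [|N IH] w alg_w; first by exists 0; [exact: algebraic0|case].
have [//|t alg_t Ht] := IH (fun i => w (lift ord0 i)).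
have [p p0 pt] := alg_t; have [q q0 qw] := alg_w ord0.
have [n [[r Er] [s Es]]] := pchar0_PET p0 pt q0 qw char0.
exists (w ord0 *+ n - t).
  apply: algebraic_sub => //; elim: n {Er Es} => [|n IHn].
    by rewrite mulr0n; exact: algebraic0.
  by rewrite mulrS; apply: algebraic_add.
move=> i; case: (unliftP ord0 i) => [j ->|->]; last by exists s.
have [g <-] := Ht j; exists (g \Po r).
by rewrite map_comp_poly horner_comp Er.
Qed.

(** The powers of a primitive element form a basis of a finite extension; it is
    stable under [D] because [D] preserves the extension. *)
Lemma exists_representation N (w : 'I_N -> F) (D : F -> F) :
    derivation D -> (forall a, exists b, D (iota a) = iota b) ->
    (forall i, algebraicOver iota (w i)) ->
  exists n (e : 'cV[F]_n) (Gam : 'M[K]_n), [/\ (0 < n)%N,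
    forall r : 'rV[K]_n, map_mx iota r *m e = 0 -> r = 0,
    map_mx D e = map_mx iota Gam *m e &
    forall i, exists A, represents iota e (w i) A].
Proof.
move=> derD Diota alg_w.
have [t [p0 np0 /rootP p0t] Ht] := primitive_element alg_w.
have char0F : [pchar F] =i pred0.
  by move=> n; rewrite (fmorph_pchar iota) char0.
pose P (q : {poly F}) := exists g, q = g^iota.
have Pder q : P q -> P q^`() by move=> [g ->]; exists g^`(); rewrite deriv_map.
have exP : exists q, [/\ q != 0, P q & q.[t] = 0].
  by exists p0^iota; split=> //; [rewrite map_poly_eq0|exists p0].
have [P0 [P0n [p EP] P0t P0't minp]] := min_root_separable char0F Pder exP.
move: P0n P0t P0't minp; rewrite EP map_poly_eq0 => p_neq0 pt p't minp.
have {}minp q : q^iota.[t] = 0 -> (size q < size p)%N -> q = 0.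
  move=> qt lt_qp; apply/eqP; rewrite -(map_poly_eq0 iota); apply/eqP.
  by apply: minp => //; [exists q|rewrite !size_map_poly].
pose n := (size p).-1.
have p1 : (1 < size p)%N.
  rewrite ltnNge; apply/negP => /size1_polyC Ep; case/eqP: p_neq0.
  by move/eqP: pt; rewrite Ep map_polyC hornerC /= fmorph_eq0 => /eqP ->.
have sp : size p = n.+1 by rewrite prednK // ltnW.
pose e : 'cV[F]_n := \col_i t ^+ i.
have ev (r : 'rV[K]_n) : map_mx iota r *m e = ((rVpoly r)^iota.[t])%:M.
  apply/matrixP => i j; rewrite !ord1 !mxE eqxx mulr1n.
  rewrite (@horner_coef_wide _ n) ?size_map_poly ?size_poly //.
  by apply: eq_bigr => l _; rewrite !mxE coef_map coef_rVpoly_ord.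
have reduce q : exists r : 'rV[K]_n, map_mx iota r *m e = (q^iota.[t])%:M.
  exists (poly_rV (q %% p)); rewrite ev poly_rV_K; last first.
    by rewrite -ltnS -sp ltn_modp.
  congr _%:M; rewrite {2}(divp_eq q p) rmorphD rmorphM /= hornerD hornerM pt.
  by rewrite mulr0 add0r.
(* K[t] is stable under D: differentiating p.[t] = 0 determines p^`().[t] * D t,
   and p^`().[t] is invertible in K[t] since p is irreducible. *)
have [s Ds] : exists s, D t = s^iota.[t].
  have := derivation_horner derD p^iota t; rewrite pt derivation0 //.
  have [b Db] := choice Diota.
  have -> : \poly_(i < size p^iota) D p^iota`_i = (\poly_(i < size p) b p`_i)^iota.
    apply/polyP => i; rewrite coef_poly [RHS]coef_map coef_poly size_map_poly.
    by case: ltnP => _; [rewrite coef_map; exact: Db|exact/esym/rmorph0].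
  move=> /esym/eqP; rewrite addrC addr_eq0 => /eqP Eb.
  have cop : coprimep p p^`().
    rewrite /coprimep; set g := gcdp p _.
    have /dvdpP[h Eh] : g %| p by exact: dvdp_gcdl.
    have g0 : g != 0 by rewrite gcdp_eq0 negb_and p_neq0.
    have gt : g^iota.[t] != 0.
      apply: contraNneq p't => gt; have /dvdpP[h' Eh'] : g %| p^`() by exact: dvdp_gcdr.
      by rewrite deriv_map Eh' rmorphM hornerM /= gt mulr0.
    have ht : h^iota.[t] = 0.
      by move/eqP: pt; rewrite Eh rmorphM hornerM mulf_eq0 (negPf gt) orbF => /eqP.
    have h0 : h != 0 by apply: contra_neq p_neq0 => h0; rewrite Eh h0 mul0r.
    have : ~~ (size h < size p)%N by apply: contraNN h0 => /(minp _ ht) ->.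
    have {1}-> : size p = (size h + size g).-1 by rewrite {1}Eh size_mul.
    have sg : (0 < size g)%N by rewrite size_poly_gt0.
    have sh : (0 < size h)%N by rewrite size_poly_gt0.
    by rewrite -leqNgt => le_s; apply/eqP; lia.
  have [[u v] /= uv] := Bezout_eq1_coprimepP _ _ cop.
  exists (v * - (\poly_(i < size p) b p`_i)); apply: (mulfI p't).
  rewrite Eb rmorphM rmorphN hornerM hornerN mulrA.
  have /(congr1 (fun f => f^iota.[t])) := uv.
  rewrite rmorphD !rmorphM rmorph1 hornerD !hornerM pt mulr0 add0r hornerC.
  by rewrite /= -deriv_map mulrC => ->; rewrite mul1r.
have mx_of (f : 'I_n -> {poly K}) : exists A : 'M[K]_n,
    map_mx iota A *m e = \col_i (f i)^iota.[t].
  have [r Hr] := choice (fun i => reduce (f i)).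
  exists (\matrix_i r i); apply/row_matrixP => i.
  rewrite row_mul -map_row rowK Hr; apply/matrixP => a b.
  by rewrite !ord1 !mxE eqxx mulr1n.
have [Gam HG] := mx_of (fun i : 'I_n => 'X^(i.-1) * s *+ i).
exists n, e, Gam; split.
- by rewrite -ltnS -sp.
- move=> r; rewrite ev => /(congr1 (fun A : 'M_1 => A 0 0)).
  rewrite !mxE eqxx mulr1n => /minp r0; apply: (can_inj rVpolyK).
  by rewrite linear0 r0 // sp ltnS size_poly.
- rewrite HG; apply/matrixP => i j; rewrite !mxE derivationXn // rmorphMn.
  by rewrite rmorphM /= map_polyXn hornerMn hornerM hornerXn Ds.
- move=> i; have [q Eq] := Ht i.
  have [A HA] := mx_of (fun j => q * 'X^j); exists A.
  rewrite /represents HA -Eq; apply/matrixP => a b; rewrite !mxE.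
  by rewrite rmorphM /= map_polyXn hornerM hornerXn.
Qed.

End FiniteExtension.

(** * Independence of logarithmic differentials *)

Section LogarithmicIndependence.
Variables (F : fieldType) (C : set F).
Hypotheses (char0 : [pchar F] =i pred0) (ringC : subring_set C).

(** The derivation [z d/dz]: extend the zero derivation of [k], the derivative
    of the transcendental [z] being free. *)
Lemma coordinate_derivation (k : set F) z : subring_set k -> transcendental k z ->
  exists D, [/\ derivation D, forall u, k u -> D u = 0 & D z = z].
Proof.
move=> ringk transk; pose G : set (F * F) := [set x | k x.1 /\ x.2 = 0].
have graphG : derivation_graph G.
  split; first by split=> //; exact: subring1.
  - by move=> u a v b [/= ku ->] [/= kv ->]; split; rewrite /= ?subrr //; exact: subringB.
  - move=> u a v b [/= ku ->] [/= kv ->].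
    by split; rewrite /= ?mul0r ?mulr0 ?addr0 //; exact: subringM.
  - by move=> a [].
have compat : graph_compat G z z.
  move=> p r Gp pz; have p0 : p = 0 by apply: transk => // i; case: (Gp i).
  have r0 : r = 0 by apply/polyP => i; rewrite coef0; case: (Gp i).
  by rewrite p0 r0 /slope linear0 !horner0 mul0r addr0.
have [D [derD DG]] := derivation_extension char0 (adjoin_graph graphG compat).
exists D; split=> //; last exact: (DG _ (adjoin_gen graphG z z)).
by move=> u ku; apply: (DG (u, 0)); apply: adjoin_incl.
Qed.

(** A relation [\sum_i c i * dlog (y i) = d v] between differentials cannot hold
    when the integers [m i] satisfy all the rational linear relations of the
    [c i] and [\prod_i y i ^ m i] is transcendental over the constants. Take this
    product [z] as the coordinate of a rational function field over which
    everything is algebraic, apply [z d/dz], and take norms and traces down to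
    that field: the orders at [z = 0] of the norms of the [y i] satisfy the
    relation of the [c i], hence that of the [m i], but the norm of [z] is a
    positive power of [z]. *)
Theorem dlog_independent N (c y : 'I_N -> F) (v z : F) (m : 'I_N -> int) :
    transcendental C z ->
    (forall i, C (c i)) -> (forall i, y i != 0) ->
    \prod_i y i ^ m i = z ->
    (forall o : 'I_N -> int, \sum_i c i * (o i)%:~R = 0 ->
       \sum_i m i * o i = 0) ->
  ~ (forall D, derivation D -> (forall u, C u -> D u = 0) ->
       \sum_i c i * (D (y i) / y i) = D v).
Proof.
move=> transC Cc y0 Ez Hm rel.
have [k [ringk Ck transk algk]] := exists_coefficient_ring ringC transC.
have [D [derD Dk Dz]] := coordinate_derivation ringk transk.
have {}rel := rel D derD (fun u Cu => Dk u (Ck u Cu)).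
have [S HS] := divring_closedP (ratfun_divring z ringk).
pose iota := sfval S.
have char0S : [pchar subfield S] =i pred0.
  by move=> n; rewrite -(fmorph_pchar iota) char0.
have ratS p : coefs_in k p -> p.[z] \in S.
  by move=> kp; rewrite HS; exact: ratfun_eval.
have kS u : k u -> u \in S.
  by move=> ku; rewrite -(hornerC u z); exact: (ratS _ (coefsC ringk ku)).
have ratS' a : iota a \in ratfun k z by rewrite -HS; exact: sfvalP.
have Diota a : exists b, D (iota a) = iota b.
  apply: sfval_surj; have /ratfunP[p [q [kp kq q0 ->]]] := ratS' a.
  have Sder g : coefs_in k g -> D g.[z] \in S.
    move=> kg; rewrite (derivation_eval derD Dk Dz kg); apply: ratS; apply: coefsM => //.
      exact: coefs_deriv.
    exact: (@coefsXn _ _ ringk 1).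
  have [Sp Sq] := (ratS p kp, ratS q kq); have [SDp SDq] := (Sder p kp, Sder q kq).
  rewrite (derivationM derD) (derivationV derD); apply: rpredD; apply: rpredM => //.
    by rewrite rpredV.
  by apply: rpredM; rewrite ?rpredN // rpredV rpredX.
have alg w : algebraicOver iota w.
  have [p [p0 pw kp]] := algk w; apply/algebraicOverP; exists p; split=> //.
    by move=> i; have [q kq <-] := kp i; exact: ratS.
  exact/rootP.
pose w i := if unlift ord0 i is Some j then y j else v.
have [n [e [Gam [n0 free_e De rep]]]] :=
  exists_representation char0S derD Diota (fun i : 'I_N.+1 => alg (w i)).
have [V] := rep ord0; rewrite /w unlift_none => repV.
have /choice[A repA] j : exists A, represents iota e (y j) A.
  by have := rep (lift ord0 j); rewrite /w liftK.
have [D0 DD0] := choice Diota.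
have [a Ea] : exists a : 'I_N -> subfield S, forall i, c i = iota (a i).
  have /choice[a Ha] i : exists x, c i = iota x by apply/sfval_surj/kS/Ck.
  by exists a.
have rel' : \sum_i iota (a i) * (D (y i) / y i) = D v.
  by rewrite -rel; apply: eq_bigr => i _; rewrite Ea.
have relN : \sum_i c i * (D (iota (\det (A i))) / iota (\det (A i))) =
    D (iota (\tr V)).
  rewrite DD0 -(trace_dlog free_e derD DD0 De y0 repA repV rel') rmorph_sum.
  by apply: eq_bigr => i _; rewrite rmorphM fmorph_div -DD0 Ea.
have norm_z : norm_is iota e z (\prod_i \det (A i) ^ m i).
  rewrite -Ez; apply: (big_rec2 (norm_is iota e)); first exact: norm_is1.
  move=> i x x' _; apply: norm_isM; apply: norm_isXz => //.
  by exists (A i).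
have [t Et] : exists t, z = iota t.
  by apply: sfval_surj; rewrite -(hornerX z); apply: ratS; exact: (@coefsXn _ _ ringk 1).
have norm_z' : norm_is iota e z (t ^+ n).
  by exists t%:M; [rewrite Et; exact: represents_scalar|rewrite det_scalar].
have Eprod := norm_is_fun free_e norm_z norm_z'.
suff n_eq0 : n = 0%N by rewrite n_eq0 in n0.
have detA0 i : \det (A i) != 0.
  by have := represents_unit free_e (y0 i) (repA i); rewrite unitmxE unitfE.
have kc i : k (c i) by exact: Ck.
have u0 i : iota (\det (A i)) != 0 by rewrite fmorph_eq0.
have ruV i : iota (\det (A i)) \in ratfun k z by exact: ratS'.
apply: (ratfun_residue ringk transk derD Dk Dz char0 kc ruV u0 (ratS' (\tr V)) relN _ Hm).
rewrite Et -rmorphXn -Eprod rmorph_prod; apply: eq_bigr => i _.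
by rewrite fmorphXz.
Qed.

End LogarithmicIndependence.

(** * Vectors, rational relations and constants *)

(** Take a matrix of maximal rank with rows in [S]: if it does not have full
    rank, its row space contains [S] and is annihilated by some vector. *)
Lemma full_or_annihilated (F : fieldType) N (S : set 'rV[F]_N) :
  (exists2 M : 'M[F]_N, M \in unitmx & forall i, S (row i M)) \/
  (exists2 c : 'cV[F]_N, c != 0 & forall v, S v -> v *m c = 0).
Proof.
pose Q r := `[< exists q (M : 'M[F]_(q, N)), (forall i, S (row i M)) /\ \rank M = r >].
have exQ : exists r, Q r.
  by exists 0%N; apply/asboolP; exists 0%N, (0 : 'M_(0, N)); split; [case|rewrite mxrank0].
have leQ r : Q r -> (r <= N)%N by move=> /asboolP[q [M [_ <-]]]; exact: rank_leq_col.
case: (ex_maxnP exQ leQ) => r /asboolP[q [M [SM rM]]] maxr.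
have [rN|rN] := eqVneq r N; [left|right].
  have full : row_full M by rewrite /row_full rM rN.
  have := fullrowsub_unit full; set M' := rowsub _ _ => uM'; exists M' => // i.
  by rewrite /M' row_rowsub; exact: SM.
have /existsP[j cj] : [exists j, col j (cokermx M) != 0].
  apply: contraR rN; rewrite negb_exists => /forallP c0.
  have : cokermx M == 0.
    apply/eqP/matrixP => a b; have /eqP/colP/(_ a) := negbNE (c0 b).
    by rewrite !mxE.
  by rewrite -mxrank_eq0 mxrank_coker rM subn_eq0 eqn_leq => ->;
     rewrite andbT -rM rank_leq_col.
exists (col j (cokermx M)) => // v Sv.
have : (v <= M)%MS.
  have sub : (M <= M + v)%MS by exact: addsmxSl.
  have /eqmxP : (M == M + v)%MS.
    rewrite -(geq_leqif (mxrank_leqif_eq sub)) rM; apply: maxr; apply/asboolP.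
    exists (q + 1)%N, (col_mx M v); split; last by rewrite addsmxE.
    move=> i; case: (splitP i) => a Ea.
      by rewrite (_ : i = lshift 1 a) ?rowKu //; exact: val_inj.
    by rewrite (_ : i = rshift q a) ?rowKd ?row_id //; exact: val_inj.
  by move=> ->; exact: addsmxSr.
by move=> /submxP[D ->]; rewrite colE mulmxA -(mulmxA D M) mulmx_coker mulmx0 mul0mx.
Qed.

Lemma common_denominator N (c : 'I_N -> rat) :
  exists2 d : int, d != 0 & exists m : 'I_N -> int, forall i, c i * d%:~R = (m i)%:~R.
Proof.
exists (\prod_i denq (c i)); first by apply/prodf_neq0 => i _; exact: denq_neq0.
exists (fun i => numq (c i) * \prod_(j | j != i) denq (c j)) => i.
rewrite (bigD1 i) //= !rmorphM mulrA; congr (_ * _).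
by rewrite -{1}(divq_num_den (c i)) divfK // intr_eq0 denq_neq0.
Qed.

Lemma intr_eq0_char0 (F : fieldType) (a : int) : [pchar F] =i pred0 ->
  ((a%:~R : F) == 0) = (a == 0).
Proof.
move=> /pcharf0P char0; case: a => n; first by rewrite -pmulrn char0.
by rewrite NegzE mulrNz oppr_eq0 -pmulrn char0.
Qed.

(** The rational linear relations of the [c i] span a proper subspace of the
    rational vectors, so that some non-zero vector is orthogonal to them. *)
Lemma integer_relations (F : fieldType) N (c : 'cV[F]_N) :
    [pchar F] =i pred0 -> c != 0 ->
  exists2 m : 'I_N -> int, exists i, m i != 0 &
    forall o : 'I_N -> int, \sum_i c i 0 * (o i)%:~R = 0 -> \sum_i m i * o i = 0.
Proof.
move=> char0 c0.
pose S : set 'rV[rat]_N := [set v | exists o : 'rV[int]_N,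
  v = map_mx intr o /\ map_mx intr o *m c = 0].
have [[M uM SM]|[r r0 Sr]] := full_or_annihilated S.
  have /choice[o Ho] := SM.
  pose M0 := \matrix_i o i.
  have EM : M = map_mx intr M0.
    by apply/row_matrixP => i; rewrite -map_row rowK; case: (Ho i).
  have M0c : map_mx intr M0 *m c = 0.
    apply/row_matrixP => i; rewrite row_mul -map_row rowK row0.
    by case: (Ho i).
  have uM0 : map_mx (intr : int -> F) M0 \in unitmx.
    rewrite unitmxE unitfE det_map_mx intr_eq0_char0 //.
    by move: uM; rewrite EM unitmxE unitfE det_map_mx intr_eq0.
  by case/eqP: c0; rewrite -(mulKmx uM0 c) M0c mulmx0.
have [d d0 [m Em]] := common_denominator (fun i => r i 0).
exists m.
  apply: contrapT => no; case/eqP: r0; apply/colP => i; rewrite mxE.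
  have /eqP := Em i; have -> : m i = 0.
    by apply/eqP; apply: contrapT => /negP mi; apply: no; exists i.
  by rewrite mulf_eq0 intr_eq0 (negPf d0) orbF => /eqP.
move=> o Ho; have Sv : S (map_mx intr (\row_i o i)).
  exists (\row_i o i); split=> //; apply/matrixP => a b; rewrite !ord1 !mxE -[RHS]Ho.
  by apply: eq_bigr => i _; rewrite !mxE mulrC.
have /(congr1 (fun A : 'M_1 => A 0 0)) := Sr _ Sv; rewrite !mxE => sum0.
apply/eqP; rewrite -(intr_eq0 rat) rmorph_sum /=; apply/eqP.
transitivity (d%:~R * \sum_i (map_mx intr (\row_i o i) : 'rV[rat]_N) 0 i * r i 0).
  rewrite mulr_sumr; apply: eq_bigr => i _.
  by rewrite rmorphM /= -Em !mxE; ring.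
by rewrite sum0 mulr0.
Qed.

(** Scale a non-zero vector of least support so that one entry becomes [1]: its
    derivatives have smaller support, hence vanish. *)
Lemma constant_vector (F : fieldType) (J : Type) (d : J -> F -> F) N
    (W : set 'cV[F]_N) : (forall j, derivation (d j)) ->
    (forall a c, W c -> W (a *: c)) -> (forall j c, W c -> W (map_mx (d j) c)) ->
    (exists2 c, W c & c != 0) ->
  exists2 c, W c & c != 0 /\ forall j i, d j (c i 0) = 0.
Proof.
move=> derd WZ Wd exc; pose supp (c : 'cV[F]_N) := #|[pred i | c i 0 != 0]|.
pose Q n := `[< exists2 c, W c & c != 0 /\ supp c = n >].
have exQ : exists n, Q n.
  by have [c Wc c0] := exc; exists (supp c); apply/asboolP; exists c.
case: (ex_minnP exQ) => n /asboolP[c Wc [c0 sc]] minn.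
have [i0 ci0] : exists i, c i 0 != 0.
  apply: contrapT => no; case/eqP: c0; apply/colP => i; rewrite mxE.
  by apply/eqP; apply: contrapT => /negP ci; apply: no; exists i.
pose b := (c i0 0)^-1 *: c.
have b_supp i : (b i 0 != 0) = (c i 0 != 0).
  by rewrite mxE mulf_eq0 invr_eq0 (negPf ci0).
have bi0 : b i0 0 = 1 by rewrite mxE mulVf.
exists b; first exact: WZ.
split=> [|j i]; first by apply/eqP => b0; move: (b_supp i0); rewrite b0 mxE eqxx ci0.
suff /colP/(_ i) : map_mx (d j) b = 0 by rewrite !mxE.
apply/eqP; apply: contrapT => /negP db0.
have : Q (supp (map_mx (d j) b)).
  by apply/asboolP; exists (map_mx (d j) b) => //; apply/Wd/WZ.
move=> /minn; rewrite leqNgt -sc => /negP; apply; apply: proper_card.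
apply/properP; split.
  apply/fintype.subsetP => l; rewrite !inE -b_supp; apply: contra_neq => bl.
  by rewrite mxE bl; exact: derivation0.
by exists i0; rewrite !inE // mxE bi0 derivation1 // eqxx.
Qed.

(** * Ax's theorem for a field with derivations *)

Section AxSchanuel.
Variables (F : fieldType) (M : nat) (d : 'I_M -> F -> F).
Hypotheses (char0 : [pchar F] =i pred0) (derd : forall j, derivation (d j)).

Definition constants : set F := [set u | forall j, d j u = 0].

Definition constant_derivation (D : F -> F) :=
  derivation D /\ forall u, constants u -> D u = 0.

Lemma constants_subring : subring_set constants.
Proof.
split=> [j|u v u0 v0 j|u v u0 v0 j]; first exact: derivation1.
  by rewrite (derivationB (derd j)) u0 v0 subrr.
by rewrite (derivationM (derd j)) u0 v0 mul0r mulr0 addr0.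
Qed.

Lemma partial_constant_derivation j : constant_derivation (d j).
Proof. by split=> // u. Qed.

Lemma bracket_constant_derivation j D : constant_derivation D ->
  constant_derivation (fun u => d j (D u) - D (d j u)).
Proof.
move=> [derD Dc]; split; first exact: derivation_bracket.
by move=> u cu; rewrite Dc // cu (derivation0 (derd j)) (derivation0 derD) subr0.
Qed.

Variables (N : nat) (x y : 'I_N -> F).
Hypotheses (y_neq0 : forall i, y i != 0).
Hypothesis exp_xy : forall j i, d j (y i) = y i * d j (x i).
Hypothesis free_x : forall m : 'I_N -> int,
  constants (\sum_i (m i)%:~R * x i) -> forall i, m i = 0.

(** The form [dy/y - dx] applied to the derivation [D]. *)
Definition dlog_sub (D : F -> F) (i : 'I_N) := D (y i) / y i - D (x i).

Lemma dlog_sub_partial j i : dlog_sub (d j) i = 0.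
Proof. by rewrite /dlog_sub exp_xy mulrAC mulfV // mul1r subrr. Qed.

(** The Lie derivative of the form [dy/y - dx] along [d j] vanishes. *)
Lemma dlog_sub_bracket j D i : derivation D ->
  dlog_sub (fun u => d j (D u) - D (d j u)) i = d j (dlog_sub D i).
Proof.
move=> derD; rewrite /dlog_sub exp_xy (derivationB (derd j)).
rewrite (derivationM derD) (derivationM (derd j)) (derivationV (derd j)) exp_xy.
by field.
Qed.

(** A product of integer powers of exponentials that is algebraic over the
    constants has zero logarithmic derivatives. *)
Lemma exp_transcendental (m : 'I_N -> int) : (exists i, m i != 0) ->
  transcendental constants (\prod_i y i ^ m i).
Proof.
set z := \prod_i _ => -[i0 mi0] p cp pz; apply/eqP; apply: contraNT mi0 => p0.
apply/eqP; apply: (free_x (m := m)) => j.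
have z0 : z != 0 by apply/prodf_neq0 => i _; exact: expfz_neq0.
have dz : d j z = 0.
  apply: (@derivation_algebraic _ char0 (d j) (fun u => `[< constants u >])) => //.
  - by move=> u /asboolP.
  - by move=> u n /asboolP cu; apply/asboolP; exact: (subringMn constants_subring n cu).
  - by exists p; split=> //; [move=> i; apply/asboolP|apply/rootP].
have : d j z / z = 0 by rewrite dz mul0r.
rewrite (dlog_prod (derd j)) => [E|i]; last exact: expfz_neq0.
rewrite -[RHS]E (derivation_sum (derd j)); apply: eq_bigr => i _.
rewrite (dlogXz (derd j)) // exp_xy [y i * _]mulrC mulfK // (derivationM (derd j)).
by rewrite (derivation_int (derd j)) mul0r add0r mulrzl.
Qed.

(** The coefficients of a relation between the forms [dy/y - dx] may be taken
    constant, because the Lie derivatives of these forms along the [d j] vanish;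
    such a relation then contradicts [dlog_independent]. *)
Theorem dlog_sub_free : exists D : 'I_N -> F -> F,
  (forall s, constant_derivation (D s)) /\
  \matrix_(s, i) dlog_sub (D s) i \in unitmx.
Proof.
pose S : set 'rV[F]_N := [set v | exists2 D, constant_derivation D &
  v = \row_i dlog_sub D i].
have [[A uA SA]|] := full_or_annihilated S.
  have SA' i : exists D, constant_derivation D /\ row i A = \row_i dlog_sub D i.
    by have [D] := SA i; exists D.
  have [D HD] := choice SA'; exists D; split=> [s|]; first by case: (HD s).
  rewrite (_ : \matrix_(s, i) _ = A) //; apply/row_matrixP => i.
  by have [_ ->] := HD i; apply/rowP => l; rewrite !mxE.
move=> [c0 c0_neq0 Sc0]; exfalso.
pose W : set 'cV[F]_N := [set c | forall D, constant_derivation D ->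
  \sum_i c i 0 * dlog_sub D i = 0].
have WZ a c : W c -> W (a *: c).
  move=> Wc D cD; transitivity (a * \sum_i c i 0 * dlog_sub D i);
    last by rewrite Wc // mulr0.
  rewrite mulr_sumr.
  by apply: eq_bigr => i _; rewrite mxE mulrA.
have Wd j c : W c -> W (map_mx (d j) c).
  move=> Wc D cD; have := Wc _ (bracket_constant_derivation j cD).
  have := congr1 (d j) (Wc D cD).
  rewrite (derivation_sum (derd j)) (derivation0 (derd j)).
  under eq_bigr do rewrite (derivationM (derd j)).
  rewrite big_split /= => + E; under [X in _ + X]eq_bigr do
    rewrite -(dlog_sub_bracket _ _ cD.1).
  by rewrite E addr0 => E'; rewrite -[RHS]E'; apply: eq_bigr => i _; rewrite mxE.
have exW : exists2 c, W c & c != 0.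
  exists c0 => // D cD.
  have /Sc0/(congr1 (fun A : 'M_1 => A 0 0)) : S (\row_i dlog_sub D i) by exists D.
  by rewrite !mxE => E; rewrite -[RHS]E; apply: eq_bigr => i _; rewrite mxE mulrC.
have [c Wc [c_neq0 dc]] := constant_vector derd WZ Wd exW.
have [m m_neq0 Hm] := integer_relations char0 c_neq0.
apply: (@dlog_independent F constants char0 constants_subring N (c^~ 0) y
  (\sum_i c i 0 * x i) _ m (exp_transcendental m_neq0)) => //.
- by move=> i j; exact: dc.
- move=> D derD Dc; have cD : constant_derivation D by [].
  apply/eqP; rewrite -subr_eq0 (derivation_sum derD) -sumrB -[X in _ == X](Wc D cD).
  apply/eqP/eq_bigr => i _; rewrite (derivationM derD) (Dc (c i 0)); last first.
    by move=> j; exact: dc.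
  by rewrite mul0r add0r -mulrBr.
Qed.

(** Elements [b] at which no non-zero derivation of the field generated by the
    [x], [y] and [h] can vanish are numerous: the derivations given by
    [dlog_sub_free] and the [d j] restrict to a space of dimension at least
    [N + \rank (d j (h s))]. *)
Theorem ax_schanuel l (h : 'I_l -> F) n (b : 'I_n -> F) :
    (forall D, constant_derivation D -> (forall e, D (b e) = 0) ->
      [/\ forall i, D (x i) = 0, forall i, D (y i) = 0 & forall s, D (h s) = 0]) ->
  (N + \rank (\matrix_(s < l, j < M) d j (h s)) <= n)%N.
Proof.
move=> Hb; have [D0 [cD0 uD0]] := dlog_sub_free.
set Jac := \matrix_(s, j) _; set Om := \matrix_(s, i) _ in uD0.
pose D (s : 'I_(N + M)) : F -> F :=
  match fintype.split s with inl a => D0 a | inr j => d j end.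
have cD s : constant_derivation (D s).
  by rewrite /D; case: fintype.split => a //; exact: partial_constant_derivation.
pose X : 'M[F]_(N, l) := \matrix_(s, i) D0 s (h i).
pose Big : 'M[F]_(N + M, N + l) := block_mx Om X 0 Jac^T.
pose B : 'M[F]_(N + M, n) := \matrix_(s, e) D s (b e).
(* Column operations clear X since Om is invertible. *)
have rBig : (N + \rank Jac <= \rank Big)%N.
  rewrite -(mxrank_tr Jac) -{1}(mxrank_unit uD0) -(@rank_diag_block_mx F).
  have <- : Big *m block_mx 1%:M (- (invmx Om *m X)) 0 1%:M = block_mx Om 0 0 Jac^T.
    rewrite mulmx_block !mulmx1 !mulmx0 !mul0mx !addr0 add0r mulmxN mulKVmx //.
    by rewrite addNr.
  exact: mxrankM_maxl.
apply: leq_trans rBig (leq_trans _ (rank_leq_col B)).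
(* A combination of the derivations that kills b also kills the x, y and h, which
   is a relation between the rows of Big. *)
have kB : kermx B *m Big = 0.
  apply/row_matrixP => a; rewrite row_mul row0.
  set r := row a _; have rB : r *m B = 0 by rewrite -row_mul mulmx_ker row0.
  pose E u := \sum_s r 0 s * D s u.
  have cE : constant_derivation E.
    split; first by apply: derivation_sumZ => s; case: (cD s).
    by move=> u cu; apply: big1 => s _; have [_ ->] := cD s; rewrite ?mulr0.
  have Eb e : E (b e) = 0.
    have /rowP/(_ e) := rB; rewrite mxE [RHS]mxE => rBe; rewrite -[RHS]rBe.
    by apply: eq_bigr => s _; rewrite [B _ _]mxE.
  have [Ex Ey Eh] := Hb E cE Eb.
  have Eomega i : \sum_s r 0 s * dlog_sub (D s) i = 0.
    transitivity (E (y i) / y i - E (x i)); last by rewrite Ex Ey mul0r subrr.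
    rewrite mulr_suml -sumrB; apply: eq_bigr => s _.
    by rewrite /dlog_sub mulrBr mulrA.
  apply/rowP => i; rewrite !mxE; case: (splitP i) => i' Ei.
    rewrite -[RHS](Eomega i'); apply: eq_bigr => s _; congr (_ * _).
    rewrite (_ : i = lshift l i'); last exact: val_inj.
    rewrite /D; case: (splitP s) => s' Es.
      by rewrite (_ : s = lshift _ s') ?block_mxEul ?mxE //; exact: val_inj.
    rewrite (_ : s = rshift N s') ?block_mxEdl ?mxE ?dlog_sub_partial //.
    exact: val_inj.
  rewrite -[RHS](Eh i'); apply: eq_bigr => s _; congr (_ * _).
  rewrite (_ : i = rshift N i'); last exact: val_inj.
  rewrite /D; case: (splitP s) => s' Es.
    by rewrite (_ : s = lshift _ s') ?block_mxEur ?mxE //; exact: val_inj.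
  by rewrite (_ : s = rshift N s') ?block_mxEdr ?mxE //; exact: val_inj.
have := mulmx0_rank_max kB; rewrite mxrank_ker.
by have := rank_leq_row B; lia.
Qed.

End AxSchanuel.

(** * Transcendence bases *)

Section TranscendenceBasis.
Variables (C K : fieldType) (iota : {rmorphism C -> K}).
Implicit Types (G B : set K) (x y : K).

Lemma gen_subfield_incl G : G `<=` gen_subfield iota G.
Proof. by move=> y Gy S _ _ GS; exact: GS. Qed.

Lemma gen_subfield_base G c : gen_subfield iota G (iota c).
Proof. by move=> S _ cS _; exact: cS. Qed.

Lemma gen_subfield_min G (S : {pred K}) : GRing.divring_closed S ->
    (forall c, iota c \in S) -> (forall y, G y -> y \in S) ->
  forall x, gen_subfield iota G x -> x \in S.
Proof. by move=> S_div cS GS x; apply. Qed.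

Lemma gen_subfield_divring G :
  exists T : divringClosed K, forall x, (x \in T) = `[< gen_subfield iota G x >].
Proof.
pose S : {pred K} := fun x => `[< gen_subfield iota G x >].
have [T HT] : exists T : divringClosed K, T =i S; last by exists T => x; rewrite HT.
apply: divring_closedP; split.
- by apply/asboolP => U [U1 _ _] _ _.
- move=> x y /asboolP Gx /asboolP Gy; apply/asboolP => U U_div cU GU.
  by have [_ UB _] := U_div; apply: UB; [exact: Gx|exact: Gy].
- move=> x y /asboolP Gx /asboolP Gy; apply/asboolP => U U_div cU GU.
  by have [_ _ UV] := U_div; apply: UV; [exact: Gx|exact: Gy].
Qed.

Lemma gen_subfieldS G B : G `<=` gen_subfield iota B ->
  gen_subfield iota G `<=` gen_subfield iota B.
Proof.
move=> GB x Gx S S_div cS BS; apply: Gx => // y /GB; exact.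
Qed.

(** It suffices to test generators, for the elements algebraic over a subfield
    form a subfield. *)
Lemma algebraic_gen_subfield G B :
    (forall y, G y -> algebraic_over (gen_subfield iota B) y) ->
  forall x, gen_subfield iota G x -> algebraic_over (gen_subfield iota B) x.
Proof.
move=> GB x Gx; have [T HT] := gen_subfield_divring B.
have algE y : algebraicOver (sfval T) y <-> algebraic_over (gen_subfield iota B) y.
  rewrite algebraicOverP; split=> -[p [p0 Tp py]]; exists p; split=> // i.
    by apply/asboolP; rewrite -HT.
  by rewrite HT; apply/asboolP.
pose S : {pred K} := fun y => `[< algebraicOver (sfval T) y >].
apply/algE/asboolP; apply: (Gx S).
- split; first by apply/asboolP; exact: algebraic1.
    by move=> y z /asboolP ay /asboolP az; apply/asboolP; exact: algebraic_sub.
  by move=> y z /asboolP ay /asboolP az; apply/asboolP; exact: algebraic_div.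
- move=> c; apply/asboolP; have [a ->] : exists a, iota c = sfval T a.
    by apply: sfval_surj; rewrite HT; apply/asboolP; exact: gen_subfield_base.
  exact: algebraic_id.
- by move=> y /GB/algE ay; apply/asboolP.
Qed.

Lemma algebraic_overS B B' x : gen_subfield iota B `<=` gen_subfield iota B' ->
  algebraic_over (gen_subfield iota B) x -> algebraic_over (gen_subfield iota B') x.
Proof. by move=> BB' [p [p0 Bp px]]; exists p; split=> // i; exact: BB'. Qed.

Lemma mcoeff_muni k (P : {mpoly C[k.+1]}) (m : 'X_{1..k.+1}) :
  ((muni P)`_(m ord_max))@_[multinom m (fintype.widen_ord (leqnSn k) i) | i < k] = P@_m.
Proof.
rewrite muniE coef_sum raddf_sum /=.
transitivity (\sum_(m' <- msupp P) if m' == m then P@_m' else 0); last first.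
  have [mP|mP] := boolP (m \in msupp P).
    rewrite (bigD1_seq m) ?msupp_uniq //= eqxx big1 ?addr0 // => m' ne.
    by rewrite (negPf ne).
  rewrite big_seq big1 => [|m' m'P]; first by rewrite memN_msupp_eq0.
  by case: eqP m'P => // ->; rewrite (negPf mP).
apply: eq_bigr => m' _; rewrite coefZ coefXn.
case: (eqVneq m' m) => [->|ne].
  by rewrite eqxx mulr1 mcoeffZ mcoeffX eqxx mulr1.
case: (eqVneq (m ord_max) (m' ord_max)) => [e1|_]; last by rewrite mulr0 mcoeff0.
rewrite mulr1 mcoeffZ mcoeffX; case: eqP => [e2|_]; last by rewrite mulr0.
case/eqP: ne; apply/mnmP => i; case: (unliftP ord_max i) => [j ->|->] //.
have /mnmP/(_ j) := e2; rewrite !mnmE.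
by have -> : lift ord_max j = fintype.widen_ord (leqnSn k) j
     by apply: val_inj; rewrite /= /bump leqNgt ltn_ord.
Qed.

Definition rcons_family k (b : 'I_k -> K) w (i : 'I_k.+1) : K :=
  if unlift ord_max i is Some j then b j else w.

(** [muni] singles out the last variable: evaluate the others at [b] and this one
    at [w]. *)
Lemma horner_muni k (b : 'I_k -> K) w (P : {mpoly C[k.+1]}) :
  (map_poly (mmap iota b) (muni P)).[w] = mmap iota (rcons_family b w) P.
Proof.
rewrite muniE rmorph_sum horner_sum /=; apply: eq_bigr => m _.
rewrite map_polyZ map_polyXn /= hornerZ hornerXn mmapZ mmapX -mulrA; congr (_ * _).
rewrite /mmap1 big_ord_recr /= /rcons_family unlift_none; congr (_ * _).
apply: eq_bigr => i _; rewrite mnmE.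
have -> : fintype.widen_ord (leqnSn k) i = lift ord_max i.
  by apply: val_inj; rewrite /= /bump leqNgt ltn_ord.
by rewrite liftK.
Qed.

(** A polynomial relation of [b] and [w], read as an equation of [w] with
    coefficients in the field generated by [b], must be identically zero; then
    so are its coefficients, which are polynomials in [b]. *)
Lemma alg_indep_rcons k (b : 'I_k -> K) w : alg_indep iota b ->
    ~ algebraic_over (gen_subfield iota (range b)) w ->
  alg_indep iota (rcons_family b w).
Proof.
move=> ind_b nalg P; rewrite -horner_muni; set p := map_poly _ _ => pw.
have p0 : p = 0.
  apply/eqP; apply: contrapT => /negP p0; apply: nalg; exists p; split=> //.
    move=> i; rewrite coef_map; set Q := (muni P)`_i.
    have [T HT] := gen_subfield_divring (range b).
    apply/asboolP; rewrite -HT /= /mmap rpred_sum // => m _.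
    rewrite rpredM ?rpred_prod // => [|j _].
      by rewrite HT; apply/asboolP; exact: gen_subfield_base.
    by rewrite rpredX // HT; apply/asboolP/gen_subfield_incl; exists j.
  exact/rootP.
apply/mpolyP => m; rewrite -mcoeff_muni (_ : _`_ _ = 0) ?mcoeff0 //.
by apply: ind_b; rewrite -[LHS]coef_map -/p p0 coef0.
Qed.

Lemma exists_transcendence_basis (s : seq K) : exists k (b : 'I_k -> K),
  [/\ forall i, b i \in s, alg_indep iota b &
      forall x, x \in s -> algebraic_over (gen_subfield iota (range b)) x].
Proof.
elim: s => [|w s [k [b [sb ind_b alg_s]]]].
  exists 0%N, (fun _ => 0); split=> [[]//||x]; last by rewrite in_nil.
  move=> P; rewrite /mmap => P0; apply/mpolyP => m; rewrite mcoeff0.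
  have Em (m' : 'X_{1..0}) : m' = m by apply/mnmP => -[].
  apply/eqP; apply: contraT => Pm; move: P0.
  rewrite (bigD1_seq m) ?msupp_uniq ?mcoeff_msupp //= big1 => [|m' /negP[]]; last exact/eqP.
  rewrite addr0 /mmap1 big_ord0 mulr1 => /eqP; rewrite fmorph_eq0.
  by rewrite (negPf Pm).
have [alg_w|nalg_w] := pselect (algebraic_over (gen_subfield iota (range b)) w).
  exists k, b; split=> // [i|x]; first by rewrite inE sb orbT.
  by rewrite inE => /predU1P[->//|/alg_s].
exists k.+1, (rcons_family b w); split; last 1 first.
- have sub : gen_subfield iota (range b) `<=`
      gen_subfield iota (range (rcons_family b w)).
    apply: gen_subfieldS => _ [j _ <-]; apply: gen_subfield_incl.
    by exists (lift ord_max j); rewrite // /rcons_family liftK.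
  move=> x; rewrite inE => /predU1P[->|/alg_s]; last exact: algebraic_overS.
  exists ('X - w%:P); split; rewrite ?polyXsubC_eq0 ?root_XsubC //.
  have [T HT] := gen_subfield_divring (range (rcons_family b w)).
  move=> i; apply/asboolP; rewrite -HT coefB coefX coefC rpredB ?rpred_nat //.
  case: eqP => _; rewrite ?rpred0 // HT; apply/asboolP/gen_subfield_incl.
  by exists ord_max; rewrite // /rcons_family unlift_none.
- move=> i; rewrite /rcons_family; case: unlift => [j|]; rewrite inE ?eqxx //.
  by rewrite sb orbT.
- exact: alg_indep_rcons.
Qed.

(** [trdeg] is only meaningful when some finite transcendence basis exists, which
    a finite set of generators ensures. *)
Lemma trdeg_basis (s : seq K) : exists b : 'I_(trdeg iota (gen_subfield iota [set` s])) -> K,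
  transcendence_basis iota (gen_subfield iota [set` s]) b.
Proof.
rewrite /trdeg; have [k [b [sb ind_b alg_b]]] := exists_transcendence_basis s.
apply: (@xgetPex _ 0%N [set k | exists b : 'I_k -> K,
  transcendence_basis iota (gen_subfield iota [set` s]) b]).
exists k, b; split=> //; first by move=> i; apply: gen_subfield_incl; exact: sb.
by apply: algebraic_gen_subfield => y; exact: alg_b.
Qed.

Lemma derivation_transcendence_basis L k (b : 'I_k -> K) D :
    [pchar K] =i pred0 -> transcendence_basis iota L b -> derivation D ->
    (forall c, D (iota c) = 0) -> (forall i, D (b i) = 0) ->
  forall x, L x -> D x = 0.
Proof.
move=> char0 [_ _ alg_b] derD Dc Db x /alg_b[p [p0 bp px]].
have Dgen u : gen_subfield iota (range b) u -> D u = 0.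
  move=> bu; apply/eqP.
  apply: (gen_subfield_min (S := [pred u | D u == 0]) _ _ _ bu).
  - exact: derivation_kernel.
  - by move=> c; rewrite inE Dc.
  - by move=> _ [i _ <-]; rewrite inE Db.
apply: (derivation_algebraic char0 (S := [pred u | D u == 0]) derD).
- by move=> u /eqP.
- by move=> u n; rewrite !inE => /eqP u0; rewrite (derivationMn derD) u0 mul0rn.
- by exists p; split=> // i; rewrite inE Dgen.
Qed.

End TranscendenceBasis.

(** * Power series *)

Section PowerSeries.
Variables (C : fieldType) (m : nat).
Local Notation fps := (fps C m).
Implicit Types (p q f : fps) (a : 'X_{1..m}) (j : 'I_m).

Lemma fps_derivD j p q : fps_deriv j (p + q) = fps_deriv j p + fps_deriv j q.
Proof. by apply: fpsP => a; exact: mulrnDl. Qed.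

(** Each coefficient of either side depends on finitely many coefficients of [p]
    and [q], so that the Leibniz rule for polynomials applies. *)
Lemma fps_derivM j p q :
  fps_deriv j (p * q) = fps_deriv j p * q + p * fps_deriv j q.
Proof.
apply: fpsP => a; pose n := (mdeg a).+2.
have tr (s : fps) b : (mdeg b < n)%N -> (fps_trunc n s)@_b = s b by exact: mcoeff_trunc.
have dtr (s : fps) b : (mdeg b < n.-1)%N -> ((fps_trunc n s)^`M(j))@_b = fps_deriv j s b.
  by move=> lt_b; rewrite mcoeff_deriv tr // mdegD mdeg1 addn1.
have tr' (s : fps) b : (mdeg b < n.-1)%N -> (fps_trunc n s)@_b = s b.
  by move=> lt_b; rewrite tr // (leq_trans lt_b).
rewrite fcoefD -[LHS]/((p * q) (a + U_(j))%MM *+ (a j).+1).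
rewrite -(fps_mul_mpoly (dtr p) (tr' q)) // -(fps_mul_mpoly (tr' p) (dtr q)) //.
rewrite -(fps_mul_mpoly (tr p) (tr q)) ?mdegD ?mdeg1 ?addn1 //.
by rewrite -mcoeff_deriv mderivM mcoeffD.
Qed.

Lemma fps_derivZ j (c : C) p : fps_deriv j (c *: p) = c *: fps_deriv j p.
Proof. by apply: fpsP => a; exact/esym/mulrnAr. Qed.

Lemma fps_deriv_const j (c : C) : fps_deriv j c%:A = 0.
Proof.
apply: fpsP => a; rewrite fps_derivZ fcoefZ /=.
suff -> : ((a + U_(j))%MM == 0%MM) = false by rewrite mul0rn mulr0.
by apply/negbTE; rewrite -mdeg_eq0 mdegD mdeg1 addn1.
Qed.

Lemma fps_deriv_sum j (I : Type) (s : seq I) (P : pred I) (f : I -> fps) :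
  fps_deriv j (\sum_(i <- s | P i) f i) = \sum_(i <- s | P i) fps_deriv j (f i).
Proof.
apply: (big_morph _ (fps_derivD j)).
by apply: fpsP => a; rewrite /= mul0rn.
Qed.

Lemma fps_derivX j p n : fps_deriv j (p ^+ n) = p ^+ n.-1 * fps_deriv j p *+ n.
Proof.
elim: n => [|n IH]; first by rewrite expr0 -(scale1r 1) fps_deriv_const.
rewrite exprS fps_derivM IH /= mulrS [in LHS]mulrC; congr (_ + _).
by case: n {IH} => [|n] /=; rewrite ?mulr0 // mulrnAr mulrA exprS.
Qed.

Section Char0.
Hypothesis char0 : [pchar C] =i pred0.

Lemma fps_deriv_eq0 f : f 0%MM = 0 -> (forall j, fps_deriv j f = 0) -> f = 0.
Proof.
move=> f0 df; apply: fpsP => a; rewrite fcoef0.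
have [->//|] := eqVneq a 0%MM; rewrite -mdeg_eq0 mdegE sum_nat_eq0.
rewrite negb_forall => /existsP[j aj].
have /(congr1 (fun p : fps => p (a - U_(j))%MM))/eqP := df j.
rewrite /= -mulr_natr mulf_eq0 ((proj1 (pcharf0P C) char0)) /= orbF.
rewrite submK; first by move/eqP.
by apply/mnm_lepP => i; rewrite mnm1E; case: eqP => [<-|]; rewrite ?lt0n.
Qed.

End Char0.
End PowerSeries.

Section Exponential.
Variables (C : fieldType) (m n : nat).
Hypothesis char0 : [pchar C] =i pred0.
Local Notation fps := (fps C m).
Implicit Types (p q : fps) (a : 'X_{1..m}) (j : 'I_m).

Lemma eq_fcoefM p p' q a :
    (forall b, (mdeg b <= mdeg a)%N -> p b = p' b) ->
  (p * q) a = (p' * q) a.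
Proof.
by move=> pp'; rewrite !fcoefM; apply: eq_bigr => k _; rewrite pp' // -ltnS bmdeg.
Qed.

Variables (f : 'I_n -> fps) (g : 'I_n -> 'I_n -> fps).
Hypothesis f0 : forall i, f i 0%MM = 0.
Local Notation A := (upper_mx f g).

Lemma upper_mxX_diag r i : (A ^+ r) i i = f i ^+ r.
Proof.
elim: r => [|r IH]; first by rewrite !expr0 mxE eqxx.
rewrite !exprS mxE (bigD1 i) //= IH mxE eqxx big1 ?addr0 // => k ki.
rewrite mxE eq_sym (negPf ki); case: ltnP => [lt_ik|_]; last by rewrite mul0r.
suff -> : (A ^+ r) k i = 0 by rewrite mulr0.
by apply: fpsP => a; rewrite fcoef_upper_expr // lt_ik.
Qed.

Lemma fcoef_exp_diag i B a : (mdeg a < B)%N ->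
  expmx A i i a = (\sum_(r < B) (r`!%:R)^-1 *: f i ^+ r : fps) a.
Proof.
move=> lt_aB; rewrite mxE /= fcoef_sum.
transitivity (\sum_(r < B) ((r`!%:R)^-1 *: (A ^+ r) i i : fps) a); last first.
  by apply: eq_bigr => r _; rewrite upper_mxX_diag.
rewrite (fsbig_ord _ _ (fun r => ((r`!%:R)^-1 *: (A ^+ r) i i : fps) a)).
apply/esym/fsbig_widen => // r [_ /= /negP]; rewrite -leqNgt => le_Br.
rewrite /= fcoef_upper_expr ?mulr0 //.
by apply/orP; right; rewrite ltn_add2r (leq_trans lt_aB).
Qed.

(** Up to a given degree the exponential is a partial sum, and the derivative of
    such a sum is the preceding one times the derivative of [f i]. *)
Lemma fps_deriv_exp_diag i j :
  fps_deriv j (expmx A i i) = expmx A i i * fps_deriv j (f i).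
Proof.
apply: fpsP => a; pose B := (mdeg a).+1.
rewrite (@eq_fcoefM _ (\sum_(r < B) (r`!%:R)^-1 *: f i ^+ r)); last first.
  by move=> b le_b; rewrite (@fcoef_exp_diag i B).
rewrite -[LHS]/(expmx A i i (a + U_(j))%MM *+ (a j).+1).
rewrite (@fcoef_exp_diag i B.+1); last by rewrite mdegD mdeg1 addn1.
set S := \sum_(r < B.+1) _; rewrite -[LHS]/(fps_deriv j S a).
congr (fcoef _ a); rewrite fps_deriv_sum big_ord_recl /= fps_derivZ fps_derivX.
rewrite mulr0n scaler0 add0r mulr_suml; apply: eq_bigr => r _.
rewrite fps_derivZ fps_derivX /= -scalerAl -scaler_nat scalerA; congr (_ *: _).
rewrite factS natrM invfM mulrC mulrA divff ?mul1r //.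
by rewrite (proj1 (pcharf0P C) char0).
Qed.

Lemma exp_diag_neq0 i : expmx A i i != 0.
Proof.
apply/eqP => /(congr1 (fun p : fps => p 0%MM)).
rewrite (@fcoef_exp_diag i 1) ?mdeg0 // big_ord_recl big_ord0 addr0 /= => /eqP.
by rewrite eqxx mulr1 invr1 oner_eq0.
Qed.

End Exponential.

Section FractionField.
Variables (C : fieldType) (m : nat).
Hypothesis char0 : [pchar C] =i pred0.
Local Notation fps := (fps C m).
Local Notation F := {fraction fps}.

(** [fps_const] as a ring morphism, which the evaluation of polynomials wants. *)
Definition fps_const_morph : {rmorphism C -> F} := @tofrac fps \o in_alg fps.

Lemma fraction_pchar0 : [pchar F] =i pred0.
Proof. by move=> p; rewrite (fmorph_pchar fps_const_morph) char0. Qed.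

(** The partial derivatives extend to the fraction field; their graphs on power
    series are graphs of derivations. *)
Lemma fraction_partials : exists d : 'I_m -> F -> F, forall j,
  derivation (d j) /\ forall p : fps, d j (tofrac p) = tofrac (fps_deriv j p).
Proof.
suff ex j : exists D : F -> F, derivation D /\
    forall p : fps, D (tofrac p) = tofrac (fps_deriv j p).
  by have [d Hd] := choice ex; exists d.
pose G : set (F * F) := [set x | exists p : fps,
  x = (tofrac p, tofrac (fps_deriv j p))].
have derivB (p q : fps) : fps_deriv j (p - q) = fps_deriv j p - fps_deriv j q.
  by apply: fpsP => a; exact: mulrnBl.
have graphG : derivation_graph G.
  split.
  - by exists 1; have := fps_deriv_const j (1 : C); rewrite scale1r => ->; rewrite tofrac1 tofrac0.
  - move=> u a v b [p [-> ->]] [q [-> ->]]; exists (p - q).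
    by rewrite derivB !tofracB.
  - move=> u a v b [p [-> ->]] [q [-> ->]]; exists (p * q).
    by rewrite fps_derivM tofracD !tofracM.
  - move=> a [p [/esym/eqP p0 ->]]; move: p0; rewrite tofrac_eq0 => /eqP ->.
    by rewrite -[0](subrr 0) derivB subrr tofrac0.
have [D [derD DG]] := derivation_extension fraction_pchar0 graphG.
by exists D; split=> // p; apply: (DG (_, _)); exists p.
Qed.

End FractionField.

(** * Exponentials of upper triangular matrices *)

(** Clear the denominators of a rational basis of the span. With integer
    combinations [\sum_j f j *~ m i j], exponentials become monomials in the
    exponentials of the [f j], so that no roots have to be extracted. *)
Lemma integral_basis (C : numFieldType) (V : lmodType C) n (f : 'I_n -> V) :
  exists m : 'I_(ratdim (ratspan f)) -> 'I_n -> int,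
    forall a : 'I_(ratdim (ratspan f)) -> int,
      \sum_i (\sum_j f j *~ m i j) *~ a i = 0 -> forall i, a i = 0.
Proof.
rewrite /ratdim.
have [k [b0 Hb0]] := ratspan_basis f.
have [b [free_b span_b]] := @xgetPex _ 0%N [set k | exists b : 'I_k -> V,
  ratfree b /\ ratspan b = ratspan f] (ex_intro _ k (ex_intro _ b0 Hb0)).
move: b free_b span_b; set N := xget _ _ => b free_b span_b.
have /choice[q Hq] i : exists q : 'I_n -> rat, b i = \sum_j ratr (q j) *: f j.
  have : ratspan b (b i).
    exists (fun l => (l == i)%:R); rewrite (bigD1 i) //= eqxx rmorph1 scale1r.
    by rewrite big1 ?addr0 // => l /negPf ->; rewrite rmorph0 scale0r.
  by rewrite span_b.
have den i : exists dm : int * ('I_n -> int), dm.1 != 0 /\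
    forall j, q i j * dm.1%:~R = (dm.2 j)%:~R.
  by have [d d0 [mi Hm]] := common_denominator (q i); exists (d, mi).
have [dm Hdm] := choice den.
exists (fun i => (dm i).2) => a sum0 i.
have E l : (\sum_j f j *~ (dm l).2 j) *~ a l = ratr ((dm l).1 * a l)%:~R *: b l.
  rewrite Hq [in RHS]intrM rmorphM /= -scaler_int mulrC -scalerA ratr_int; congr (_ *: _).
  rewrite scaler_sumr; apply: eq_bigr => j _.
  by rewrite scalerA -rmorphM mulrC (Hdm l).2 rmorph_int scaler_int.
have /(_ i)/eqP := free_b _ (eq_trans (eq_bigr _ (fun l _ => esym (E l))) sum0).
by rewrite intr_eq0 mulf_eq0 (negPf (Hdm i).1) /= => /eqP.
Qed.

Theorem corollary4p1 (R : realType) (n m : nat) (hn : (0 < n)%N) (hm : (0 < m)%N)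
    (f : 'I_n -> fps R[i] m) (g : 'I_n -> 'I_n -> fps R[i] m)
    (hf : forall i, f i 0%MM = 0) :
  let A := upper_mx f g in
  let N := ratdim (ratspan f) in
  (N + \rank (jacobian f g) <=
     trdeg (@fps_const R[i] m)
       (gen_subfield (@fps_const R[i] m) (mx_entries A `|` mx_entries (expmx A))))%N.
Proof.
cbv zeta; set A := upper_mx f g; set N := ratdim _.
have char0 : [pchar R[i]] =i pred0 by exact: pchar_num.
have char0F := fraction_pchar0 m char0.
have [d /all_and2[derd dE]] := fraction_partials m char0.
pose iota := fps_const_morph R[i] m.
pose gens := [seq tofrac (A ij.1 ij.2) | ij : 'I_n * 'I_n] ++
             [seq tofrac (expmx A ij.1 ij.2) | ij : 'I_n * 'I_n].
have gensE : mx_entries A `|` mx_entries (expmx A) = [set` gens].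
  apply/seteqP; split=> [_ [[i [j ->]]|[i [j ->]]]|z] /=.
  - by rewrite mem_cat; apply/orP; left; apply/fintype.imageP; exists (i, j).
  - by rewrite mem_cat; apply/orP; right; apply/fintype.imageP; exists (i, j).
  - rewrite mem_cat => /orP[/fintype.imageP[ij _ ->]|/fintype.imageP[ij _ ->]]; [left|right];
    by exists ij.1, ij.2.
rewrite gensE -[@fps_const _ _]/(iota : _ -> _); set L := gen_subfield _ _.
have [b basis_b] := trdeg_basis iota gens.
have [mi free_mi] := integral_basis f.
pose x (i : 'I_N) : {fraction fps R[i] m} := tofrac (\sum_j f j *~ mi i j).
pose E j : {fraction fps R[i] m} := tofrac (expmx A j j).
pose y (i : 'I_N) := \prod_j E j ^ mi i j.
have E0 j : E j != 0 by rewrite tofrac_eq0; exact: exp_diag_neq0.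
have y0 i : y i != 0 by apply/prodf_neq0 => j _; exact: expfz_neq0.
have xE i : x i = \sum_j tofrac (f j) *~ mi i j.
  by rewrite /x rmorph_sum; apply: eq_bigr => j _; rewrite rmorphMz.
have exp_xy e i : d e (y i) = y i * d e (x i).
  have := dlog_prod (derd e) (fun j => expfz_neq0 (mi i j) (E0 j)).
  move=> /(canRL (divfK (y0 i))); rewrite -/(y i) mulrC => ->; congr (_ * _).
  rewrite xE (derivation_sum (derd e)); apply: eq_bigr => j _.
  rewrite (dlogXz (derd e)) // (derivationMz (derd e)) dE fps_deriv_exp_diag // tofracM -dE mulrC.
  by rewrite mulKf.
have free_x (a : 'I_N -> int) : constants d (\sum_i (a i)%:~R * x i) ->
    forall i, a i = 0.
  pose u := \sum_i (\sum_j f j *~ mi i j) *~ a i.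
  have -> : \sum_i (a i)%:~R * x i = tofrac u.
    by rewrite rmorph_sum; apply: eq_bigr => i _; rewrite mulrzl rmorphMz.
  move=> cu; apply: free_mi; apply: (fps_deriv_eq0 char0).
    have c0 (p : fps R[i] m) (k : int) : p 0%MM = 0 -> (p *~ k) 0%MM = 0.
      by rewrite -scaler_int fcoefZ => ->; rewrite mulr0.
    rewrite fcoef_sum big1 // => i _; apply: (c0).
    by rewrite fcoef_sum big1 // => j _; exact: c0.
  move=> e; apply/eqP; rewrite -tofrac_eq0 -dE; exact/eqP/cu.
pose h (s : 'I_#|upper_pairs n|) : {fraction fps R[i] m} :=
  tofrac (A (enum_val s).1 (enum_val s).2).
have -> : jacobian f g = \matrix_(s, e) d e (h s).
  by apply/matrixP => s e; rewrite [LHS]mxE [RHS]mxE; exact/esym/dE.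
apply: (ax_schanuel char0F derd y0 exp_xy free_x (h := h) (b := b)).
move=> D [derD Dc] Db.
have [T HT] := gen_subfield_divring iota [set` gens].
have Diota c : D (iota c) = 0.
  by apply: Dc => e; rewrite [d e _](dE e) fps_deriv_const tofrac0.
have LD := derivation_transcendence_basis char0F basis_b derD Diota Db.
have TL z : z \in T -> D z = 0 by rewrite HT => /asboolP/LD.
have TA i j : tofrac (A i j) \in T.
  rewrite HT; apply/asboolP/gen_subfield_incl; rewrite -gensE; left.
  by exists i, j.
have TE i : E i \in T.
  rewrite HT; apply/asboolP/gen_subfield_incl; rewrite -gensE; right.
  by exists i, i.
have Tf j : tofrac (f j) \in T by have := TA j j; rewrite [A j j]mxE eqxx.
split=> [i|i|s]; apply: TL; last exact: TA.
  by rewrite xE rpred_sum // => j _; rewrite rpredMz.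
apply: rpred_prod => j _; apply: rpredXz; exact: TE.
Qed.
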